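(* Let $G$ be a 2-connected subcubic graph and let $x,y,z$ be distinct vertices of $G$. If $d(v)=3$ for all $v\in V(G)\setminus\{x,y,z\}$, then there are two $x-y$ paths $P_1,P_2$ in $G$ with $1\leq |E(P_1)|-|E(P_2)|\leq 2$.
   Context: All graphs are finite and simple. A subcubic graph is a graph of maximum degree at most 3; $d(v)$ denotes the degree of $v$. *)

(* Defs.v *)
(* A finite simple graph is a symmetric irreflexive relation
   [e : rel T] (adjacency) on a finite type [T] of vertices. *)
From mathcomp Require Import all_boot.

Set Implicit Arguments.
Unset Strict Implicit.
Unset Printing Implicit Defensive.

Section Graph.
Variables (T : finType) (e : rel T).

Definition degree (v : T) : nat := #|[set w | e v w]|.

Definition subcubic : Prop := forall v, degree v <= 3.

Definition del_verts (X : {set T}) : rel T :=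
  [rel u v | [&& u \notin X, v \notin X & e u v]].

Definition connected_without (X : {set T}) : Prop :=
  forall u v, u \notin X -> v \notin X -> connect (del_verts X) u v.

Definition k_connected (k : nat) : Prop :=
  k < #|T| /\ forall X : {set T}, #|X| < k -> connected_without X.

(* The path has vertices [x :: p], pairwise distinct, so it has [size p]
   edges. *)
Definition is_path (x y : T) (p : seq T) : bool :=
  [&& path e x p, uniq (x :: p) & last x p == y].

End Graph.

(* Main.v *)
(** Following Bondy and Vince.  The statement is proved by induction in a form where [x] and
    [y] may have any degree and only the graph with the edge [xy] added is 2-connected.  If the
    graph minus [x, y] is a forest, the end of a longest path gives the two paths.  Otherwise
    take a cycle [C] avoiding [x, y] that maximises the component [K] of [x, y] in [G + xy - C]:
    since [C] consists of vertices of degree 3, an ear of [C] outside [K] would allow [K] to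
    grow, so every vertex of [C], except perhaps [z], has exactly one neighbour in [K].

    Two vertices of [K] are linked if disjoint paths in [K] join them to [x] and [y]; being
    unlinked is an equivalence relation.  If two vertices of [C] bounding arcs whose lengths
    differ by 1 or 2 have linked neighbours, we are done.  Otherwise either all neighbours of
    [C] in [K] are equivalent, against 2-connectivity, or [C] has length [2m] with [m] odd and
    the neighbours of the even and of the odd vertices form two classes.  The class [M] of the
    even ones is attached to the rest of [K] at a single vertex [p]; the induction hypothesis,
    applied to [M] with all of [C] contracted to a second root, gives two paths from [p] to [C]
    whose lengths differ by 1 or 2, and both continue along arcs of equal length to a common odd
    vertex of [C]. *)
Require Import Defs.
From mathcomp Require Import all_boot.
From mathcomp Require Import zify.

Set Implicit Arguments.
Unset Strict Implicit.
Unset Printing Implicit Defensive.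

(** * Reachability and paths inside a vertex set *)

Section Restriction.
Variable T : finType.
Implicit Types (r e : rel T) (S : {set T}).

(** The induced subgraph, kept as a relation on all of [T]: a vertex outside [S] is isolated, but
    still connected to itself. *)
Definition restr r S : rel T := [rel a b | [&& a \in S, b \in S & r a b]].

Lemma restr_sym r S : symmetric r -> symmetric (restr r S).
Proof. by move=> rs a b; rewrite /restr /= rs andbCA. Qed.

Lemma connect_mono r r' a b :
  (forall u v, r u v -> r' u v) -> connect r a b -> connect r' a b.
Proof. by move=> rr'; apply: connect_sub => u v /rr' /connect1. Qed.

Lemma connect_restrS r S S' a b :
  S \subset S' -> connect (restr r S) a b -> connect (restr r S') a b.
Proof.
move=> /subsetP sSS'; apply: connect_mono => u v /and3P[/sSS' uS /sSS' vS uv].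
exact/and3P.
Qed.

Lemma connect_revE r a b : symmetric r -> connect r a b = connect r b a.
Proof. by move=> rs; apply: (sym_connect_sym rs). Qed.

Lemma connect_restr_in r S a b : a \in S -> connect (restr r S) a b -> b \in S.
Proof.
move=> aS /connectP[s sP ->]; elim: s a aS sP => //= c s IH a aS /andP[/and3P[_ cS _] /IH].
exact.
Qed.

Lemma connect_restr_closed r S a b :
  a \in S -> (forall u v, u \in S -> r u v -> v \in S) ->
  connect r a b -> connect (restr r S) a b.
Proof.
move=> aS cl /connectP[s sP ->]; elim: s a aS sP => //= c s IH a aS /andP[ac cs].
have cS := cl _ _ aS ac; apply: connect_trans (connect1 _) (IH _ cS cs).
by rewrite /restr /= aS cS.
Qed.

(** The way connectivity is used throughout: it yields the first edge leaving [S] on a path,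
    together with the stretch before it. *)
Lemma connect_exit r S a b :
  connect r a b -> a \in S -> b \notin S ->
  exists u v, [/\ u \in S, v \notin S, r u v & connect (restr r S) a u].
Proof.
move=> /connectP[s sP ->]; elim: s a sP => [|c s IH] a /=; first by move=> _ ->.
move=> /andP[ac cs] aS lS; have [cS|cS] := boolP (c \in S); last by exists a, c.
have [u [v [uS vS uv cu]]] := IH _ cs cS lS; exists u, v; split=> //.
by apply: connect_trans (connect1 _) cu; rewrite /restr /= aS cS.
Qed.

(** The vertices are distinct, so this is a path with exactly [l] edges; [s] omits the start [u]. *)
Definition walk e S u v l :=
  exists s, [/\ path e u s, last u s = v, uniq (u :: s),
                {subset u :: s <= S} & size s = l].

Lemma walkS e S S' u v l : S \subset S' -> walk e S u v l -> walk e S' u v l.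
Proof.
by move=> /subsetP sS [s [? ? ? sub ?]]; exists s; split=> // a /sub /sS.
Qed.

Lemma walk_rev e S u v l : symmetric e -> walk e S u v l -> walk e S v u l.
Proof.
move=> es [s [sP sl su sS <-]]; exists (rev (belast u s)).
have rE : v :: rev (belast u s) = rev (u :: s) by rewrite [in RHS]lastI sl rev_rcons.
split.
- rewrite -sl rev_path; apply: sub_path sP => a b; by rewrite /= es.
- by rewrite -(last_cons u) rE rev_cons last_rcons.
- by rewrite rE rev_uniq.
- by move=> a; rewrite rE mem_rev; apply: sS.
- by rewrite size_rev size_belast.
Qed.

Lemma walk_glue e S S' u v w l l' :
  walk e S u v l -> walk e S' v w l' ->
  (forall a, a \in S -> a \in S' -> a = v) -> walk e (S :|: S') u w (l + l').
Proof.
move=> [s [sP sl su sS <-]] [s' [sP' sl' su' sS' <-]] dis; exists (s ++ s'); split.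
- by rewrite cat_path sP sl.
- by rewrite last_cat sl.
- rewrite -cat_cons cat_uniq su /=; move: su' => /= /andP[vs' ->]; rewrite andbT.
  apply/hasPn=> a as'; apply/negP=> as_.
  by move: vs'; rewrite -(dis a) ?as' //; [apply: sS | apply: sS'; rewrite inE as' orbT].
- move=> a; rewrite -cat_cons mem_cat in_setU => /orP[/sS -> //|as'].
  by rewrite (sS' a) ?orbT // inE as' orbT.
- by rewrite size_cat.
Qed.

Lemma walk_edge e S S' u v v' w l l' :
  walk e S u v l -> e v v' -> walk e S' v' w l' -> [disjoint S & S'] ->
  walk e (S :|: S') u w (l + l').+1.
Proof.
move=> [s [sP sl su sS <-]] vv' [s' [sP' sl' su' sS' <-]] dis.
exists (s ++ v' :: s'); split.
- by rewrite cat_path sP sl /= vv'.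
- by rewrite last_cat.
- rewrite -cat_cons cat_uniq su su' andbT; apply/hasPn=> a as'.
  by apply/negP=> /sS aS; move/disjointFr: dis => /(_ _ aS); rewrite sS'.
- by move=> a; rewrite -cat_cons mem_cat in_setU => /orP[/sS -> //|/sS' ->]; rewrite orbT.
- by rewrite size_cat /= addnS.
Qed.

Lemma connect_walk e S u v :
  u \in S -> connect (restr e S) u v -> exists l, walk e S u v l.
Proof.
move=> uS /connectP[s0 /shortenP[s sP su _] ->]; exists (size s), s; split=> //.
- by apply: sub_path sP => a b /and3P[].
- elim: s u uS sP {su} => [|c s IH] u uS /=; first by move=> _ a; rewrite inE => /eqP->.
  move=> /andP[/and3P[_ cS _] /(IH _ cS) sub] a; rewrite inE => /orP[/eqP->|/sub] //.
Qed.

End Restriction.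

(** * Linked sets *)

Section Linked.
Variables (T : finType) (e : rel T).
Hypothesis e_sym : symmetric e.
Variables (x y : T).
Hypothesis xy : x != y.
Implicit Types (K S M : {set T}).

Definition ends (s t : T) := (s, t) \in [:: (x, y); (y, x)].

Lemma ends_sym s t : ends s t -> ends t s.
Proof.
by rewrite /ends !inE !xpair_eqE => /orP[]/andP[-> ->]; rewrite ?orbT.
Qed.

Definition linked K (u v : T) : bool :=
  [exists S : {set T}, exists S' : {set T}, exists s, exists t,
    [&& [&& [disjoint S & S'], S \subset K & S' \subset K],
        [&& u \in S, v \in S' & ends s t],
        connect (restr e S) u s & connect (restr e S') v t]].

Lemma linkedI K S S' s t u v :
  [disjoint S & S'] -> S \subset K -> S' \subset K ->
  u \in S -> v \in S' -> ends s t ->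
  connect (restr e S) u s -> connect (restr e S') v t -> linked K u v.
Proof.
move=> *; apply/existsP; exists S; apply/existsP; exists S'.
by apply/existsP; exists s; apply/existsP; exists t; apply/and4P; split=> //; apply/and3P.
Qed.

Lemma connect_component S s :
  forall v, v \in [set a in S | connect (restr e S) a s] ->
  connect (restr e [set a in S | connect (restr e S) a s]) v s.
Proof.
move=> v; set S0 := [set a in S | _]; rewrite inE => /andP[vS vs].
have v0 : v \in S0 by rewrite inE vS.
have /(connect_mono _) : connect (restr (restr e S) S0) v s.
  apply: connect_restr_closed vs => // a b; rewrite !inE => /andP[aS as_] ab.
  have/and3P[_ -> _] := ab; apply: connect_trans (connect1 _) as_.
  by rewrite restr_sym.
by apply=> a b /and3P[aS bS /and3P[_ _ ab]]; apply/and3P.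
Qed.

(** The two sets can be shrunk to the vertices that reach their root inside them, so that every
    vertex of either set can serve as a start. *)
Lemma linkedE K u v : linked K u v ->
  exists S S' s t,
    [/\ [/\ [disjoint S & S'], S \subset K & S' \subset K],
        [/\ u \in S, v \in S' & ends s t],
        forall a, a \in S -> connect (restr e S) a s &
        forall a, a \in S' -> connect (restr e S') a t].
Proof.
move=> /existsP[S /existsP[S' /existsP[s /existsP[t]]]].
move=> /and4P[/and3P[dis SK SK'] /and3P[uS vS' st] us vt].
exists [set a in S | connect (restr e S) a s], [set a in S' | connect (restr e S') a t], s, t.
have sub (S1 : {set T}) (P : pred T) : [set a in S1 | P a] \subset S1.
  by apply/subsetP=> a; rewrite inE => /andP[].
split; try exact: connect_component.
- split; [|exact: subset_trans SK|exact: subset_trans SK'].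
  exact: disjointWl (sub _ _) (disjointWr (sub _ _) dis).
- by rewrite !inE uS vS' us vt.
Qed.

Lemma linked_sym K u v : linked K u v -> linked K v u.
Proof.
move=> /linkedE[S [S' [s [t [[dis SK SK'] [uS vS' st] us vt]]]]].
by apply: (linkedI (S:=S') (S':=S) (s:=t) (t:=s)); rewrite 1?disjoint_sym 1?ends_sym; auto.
Qed.

Lemma linked_irr K u : ~~ linked K u u.
Proof.
by apply/negP=> /linkedE[S [S' [s [t [[dis _ _] [uS uS' _] _ _]]]]];
rewrite (disjointFr dis uS) in uS'.
Qed.

Lemma linked_roots K : x \in K -> y \in K -> linked K x y.
Proof.
move=> xK yK; apply: (@linkedI K [set x] [set y] x y); rewrite ?sub1set ?set11 ?connect0 //.
  by rewrite disjoints1 inE.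
by rewrite /ends !inE eqxx.
Qed.

(* Follow a path from [b] to a root until it first meets one of the two linking sets: it
   can then replace the corresponding start. *)
Lemma linked_exchange K a b c t :
  linked K a c -> b \in K -> t \in [:: x; y] -> connect (restr e K) b t ->
  linked K a b \/ linked K b c.
Proof.
move=> /linkedE[S [S' [s [t' [[dis SK SK'] [aS cS' st] as_ ct]]]]] bK txy bt.
have sS := connect_restr_in aS (as_ _ aS); have tS := connect_restr_in cS' (ct _ cS').
have [bS|bS] := boolP (b \in S); first by right; apply: (linkedI dis _ _ bS cS' st); auto.
have [bS'|bS'] := boolP (b \in S'); first by left; apply: (linkedI dis _ _ aS bS' st); auto.
have bU : b \in ~: (S :|: S') by rewrite !inE negb_or bS.
have tU : t \notin ~: (S :|: S').
  rewrite !inE negbK; move: st txy; rewrite /ends !inE !xpair_eqE.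
  by move=> /orP[]/andP[/eqP<- /eqP<-] /orP[]/eqP->; rewrite ?sS ?tS ?orbT.
have [u [v [uU vU uv bu]]] := connect_exit bt bU tU.
have/and3P[uK vK euv] := uv.
(* The set that the path meets absorbs all of [K] outside both linking sets. It then contains [b]
   and the stretch of the path before the meeting point, and stays disjoint from the other set. *)
have step (S1 S2 : {set T}) s1 : [disjoint S1 & S2] -> S1 \subset K ->
    S1 \subset S :|: S' -> S2 \subset S :|: S' ->
    (forall a, a \in S1 -> connect (restr e S1) a s1) -> v \in S1 ->
  let S3 := S1 :|: (K :\: (S :|: S')) in
    [/\ [disjoint S3 & S2], S3 \subset K, b \in S3 & connect (restr e S3) b s1].
  move=> d12 S1K S1U S2U cS1 vS1 S3.
  have sub1 : S1 \subset S3 by apply: subsetUl.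
  have sub2 : K :\: (S :|: S') \subset S3 by apply: subsetUr.
  split.
  - apply/pred0P=> d /=; apply/negP=> /andP[]; rewrite in_setU => /orP[dS1|].
      by rewrite (disjointFr d12 dS1).
    by rewrite in_setD => /andP[dU _] /(subsetP S2U) dU'; rewrite dU' in dU.
  - by rewrite subUset S1K subsetDl.
  - by apply: (subsetP sub2); rewrite in_setD bK andbT -in_setC.
  - apply: connect_trans (_ : connect _ b u) _.
      move: bu; apply: connect_mono => f g /and3P[fU gU /and3P[fK gK fg]]; apply/and3P; split=> //;
      by apply: (subsetP sub2); rewrite in_setD ?fK ?gK andbT -in_setC.
    apply: connect_trans (connect1 _) (connect_restrS sub1 (cS1 _ vS1)).
    apply/and3P; split=> //; last exact: (subsetP sub1).
    by apply: (subsetP sub2); rewrite in_setD uK andbT -in_setC.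
move: vU; rewrite !inE negbK => /orP[vS|vS'].
- have [d3 S3K bS3 bs] := step S S' s dis SK (subsetUl _ _) (subsetUr _ _) as_ vS.
  by right; apply: (linkedI d3 _ _ bS3 cS' st); auto.
- rewrite disjoint_sym in dis.
  have [d3 S3K bS3 bs] := step S' S t' dis SK' (subsetUr _ _) (subsetUl _ _) ct vS'.
  by left; apply/linked_sym; apply: (linkedI d3 _ _ bS3 aS (ends_sym st)); auto.
Qed.

(** The linking sets avoid [m], so [m] can be added to the one that starts at its neighbour [u]. *)
Lemma linked_extend K m u c :
  m \in K -> e m u -> linked (K :\ m) u c -> linked K m c.
Proof.
move=> mK mu /linkedE[S [S' [s [t [[dis SK SK'] [uS cS' st] us ct]]]]].
have mS' : m \notin S' by apply/negP=> /(subsetP SK'); rewrite !inE eqxx.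
apply: (linkedI (S := m |: S) (S' := S') _ _ _ _ cS' st _ (ct _ cS')).
- by rewrite -setI_eq0 setIUl setU_eq0 !setI_eq0 disjoints1 mS'.
- by rewrite subUset sub1set mK (subset_trans SK) ?subsetDl.
- exact: subset_trans SK' (subsetDl _ _).
- by rewrite !inE eqxx.
- apply: connect_trans (connect1 _) (connect_restrS (subsetUr _ _) (us _ uS)).
  by apply/and3P; split=> //; rewrite !inE ?eqxx ?uS ?orbT.
Qed.

Section Classes.
Variable K : {set T}.
Hypotheses (xK : x \in K) (yK : y \in K).
Hypothesis reachK : forall w, w \in K ->
  exists2 t, t \in [:: x; y] & connect (restr e K) w t.

(** The contrapositive of [linked_exchange]; it makes being unlinked an equivalence relation on
    [K]. *)
Lemma unlinked_trans b a c :
  b \in K -> ~~ linked K a b -> ~~ linked K b c -> ~~ linked K a c.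
Proof.
move=> bK nab nbc; apply/negP=> ac; have [t txy bt] := reachK bK.
by have [ab|bc] := linked_exchange ac bK txy bt; [rewrite ab in nab | rewrite bc in nbc].
Qed.

Definition linkclass m : {set T} := [set w in K | ~~ linked K w m].

(* A link class is a hanging part of [K + xy], attached at [p]. *)
Lemma linkclass_top m0 : m0 \in K ->
  exists2 p, p \in linkclass m0 &
    forall m, m \in linkclass m0 -> m != p ->
      m \notin [:: x; y] /\ forall u, u \in K -> e m u -> u \in linkclass m0.
Proof.
move=> m0K; set M := linkclass m0.
have m0M : m0 \in M by rewrite inE m0K linked_irr.
have inM a b : a \in M -> b \in M -> ~~ linked K a b.
  rewrite !inE => /andP[_ na] /andP[_ nb]; apply: unlinked_trans m0K na _.
  by apply: contra nb => /linked_sym.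
have notxy : x \in M -> y \in M -> False.
  by move=> xM yM; have := inM _ _ xM yM; rewrite linked_roots.
(* [p] is the root in [M] if there is one, and otherwise the vertex at which a path from a root to
   [m0] first enters [M]. Either way [p] reaches a root without meeting another vertex of [M]. *)
have [p [t [pM txy pxy pt]]] : exists p t, [/\ p \in M, t \in [:: x; y],
    forall m, m \in M -> m \in [:: x; y] -> m = p &
    forall m, m \in M -> m != p -> connect (restr e (K :\ m)) p t].
  have [xM|xM] := boolP (x \in M).
    exists x, x; split=> // [|m mM]; first by rewrite mem_head.
    by rewrite !inE => /orP[]/eqP // my; case: (notxy xM); rewrite -my.
  have [yM|yM] := boolP (y \in M).
    exists y, y; split=> // [|m mM]; first by rewrite !inE eqxx orbT.
    by rewrite !inE => /orP[]/eqP // mx; rewrite -mx mM in xM.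
  have [t txy m0t] := reachK m0K.
  have tM : t \in ~: M by move: txy; rewrite in_setC !in_cons in_nil orbF => /orP[]/eqP->.
  rewrite connect_revE in m0t; last exact: restr_sym.
  have m0M' : m0 \notin ~: M by rewrite in_setC m0M.
  have [u [p [uM pM up tu]]] := connect_exit m0t tM m0M'.
  have/and3P[uK pK eup] := up.
  rewrite in_setC negbK in pM; exists p, t; split=> // m mM.
    by rewrite in_cons mem_seq1 => /orP[]/eqP mE; move: xM yM; rewrite -mE mM.
  move=> mp; apply: connect_trans (connect1 (_ : restr e (K :\ m) p u)) _.
    apply/and3P; split; rewrite ?inE 1?e_sym // ?pK ?uK ?andbT 1?eq_sym //.
    by apply/negP=> /eqP mu; rewrite -mu in_setC mM in uM.
  rewrite connect_revE; last exact: restr_sym.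
  move: tu; apply: connect_mono => f g /and3P[fM gM /and3P[fK gK fg]].
  by apply/and3P; split; rewrite ?inE ?fK ?gK ?andbT //; apply/negP=> /eqP fm;
     [move: fM | move: gM]; rewrite fm in_setC mM.
exists p => // m mM mp.
have mxy : m \notin [:: x; y] by apply/negP=> /(pxy _ mM) /eqP; rewrite (negPf mp).
(* If [u] is outside [M], it is linked to [m]. Let [c] be the vertex before [m] on the linking path
   at [m]: then [u] and [c] are linked in [K :\ m], and an exchange with [p] followed by
   [linked_extend] links [m] to [p], though both lie in [M]. *)
split=> // u uK mu; apply/negPn/negP=> uM.
have mK : m \in K by move: mM; rewrite inE => /andP[].
have pK : p \in K by move: pM; rewrite inE => /andP[].
have /linkedE[S [S' [s [t' [[dis SK SK'] [uS mS' st] us ct]]]]] : linked K u m.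
  have [//|num] := boolP (linked K u m); move/negP: uM; case; rewrite inE uK.
  by apply: unlinked_trans mK num _; move: mM; rewrite inE => /andP[].
have tm : t' != m.
  apply/negP=> /eqP tm; move: mxy st; rewrite -tm /ends !inE !xpair_eqE.
  by move=> /norP[/negPf-> /negPf->]; rewrite !andbF.
have tS' := connect_restr_in mS' (ct _ mS').
have tm' : connect (restr e S') t' m by rewrite connect_revE ?ct //; apply: restr_sym.
have [c [m' [cS cm' cm tc]]] : exists c m', [/\ c \in S' :\ m, m' \notin S' :\ m, restr e S' c m' &
      connect (restr (restr e S') (S' :\ m)) t' c].
  by apply: connect_exit tm' _ _; rewrite !inE ?tm ?tS' ?eqxx.
have/and3P[cS' mS'' ecm] := cm.
have mE : m' = m by move: cm'; rewrite !inE mS'' andbT negbK => /eqP.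
rewrite {m' mS'' cm' cm}mE in ecm.
have mS : m \notin S by rewrite (disjointFl dis mS').
have link : linked (K :\ m) u c.
  apply: (linkedI (S := S) (S' := S' :\ m) _ _ _ uS cS st (us _ uS)).
  - exact: disjointWr (subsetDl _ _) dis.
  - apply/subsetP=> a aS; rewrite !inE (subsetP SK) // andbT.
    by apply: contra mS => /eqP <-.
  - exact: setSD.
  - rewrite connect_revE; last exact: restr_sym.
    move: tc; apply: connect_mono => f g /and3P[fM gM /and3P[fK gK fg]]; exact/and3P.
have pKm : p \in K :\ m by rewrite !inE eq_sym mp.
move/negP: (inM _ _ mM pM); apply.
have [up|pc] := linked_exchange link pKm txy (pt _ mM mp).
  exact: linked_extend mK mu up.
by apply: linked_extend mK _ (linked_sym pc); rewrite e_sym.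
Qed.

End Classes.
End Linked.

(** * Arcs of a cycle *)

Section Arcs.
Variables (T : finType) (e : rel T).
Hypothesis e_sym : symmetric e.

Lemma arc_head d cs k : cycle e cs -> uniq cs -> k < size cs ->
  walk e [set a in cs] (nth d cs 0) (nth d cs k) k.
Proof.
case: cs => // c s; rewrite /cycle rcons_path => /andP[sP _] su ks.
exists (take k s); split.
- by have := sP; rewrite -{1}(cat_take_drop k s) cat_path => /andP[].
- by rewrite (last_nth d) size_takel //; case: k ks => //= k ks; rewrite nth_take.
- by have := take_uniq k.+1 su.
- by move=> a at_; rewrite inE; apply: (mem_take (n0 := k.+1)).
- by rewrite size_takel.
Qed.

(** By truncated subtraction [(i - j) + (j - i)] is the distance of the positions; the two values of
    [l] are the lengths of the two arcs between them. *)
Lemma arc_walk d cs i j l : cycle e cs -> uniq cs ->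
  i < size cs -> j < size cs -> i != j ->
  l = (i - j) + (j - i) \/ l = size cs - ((i - j) + (j - i)) ->
  walk e [set a in cs] (nth d cs i) (nth d cs j) l.
Proof.
(* Rotating the cycle to start at [i'] turns a forward arc into an initial segment. *)
move=> cP cu; have fwd i' k : i' < size cs -> k < size cs ->
    walk e [set a in cs] (nth d cs i')
      (nth d cs (if i' + k < size cs then i' + k else i' + k - size cs)) k.
  move=> i'n kn; have := @arc_head d (rot i' cs) k.
  rewrite rot_cycle rot_uniq size_rot => /(_ cP cu kn).
  have -> : [set a in rot i' cs] = [set a in cs] by apply/setP=> a; rewrite !inE mem_rot.
  rewrite /rot !nth_cat size_drop.
  have -> : 0 < size cs - i' by lia.
  rewrite !nth_drop addn0; case: (ltnP k (size cs - i')) => h.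
    by have -> : i' + k < size cs by lia.
  have -> : (i' + k < size cs) = false by lia.
  by rewrite nth_take; [congr walk; congr nth|]; lia.
move=> i_n jn ij le_l.
wlog ij' : i j i_n jn ij le_l / i < j.
  move=> H; case: (ltnP i j) => h; first exact: H.
  by apply: walk_rev => //; apply: H; lia.
case: le_l => ->.
  have := fwd i (j - i) i_n; rewrite ifT; last lia.
  by rewrite (subnKC (ltnW ij')) (_ : i - j + (j - i) = j - i); [apply|]; lia.
apply: walk_rev => //; have := fwd j (size cs - (j - i)) jn; rewrite ifF; last lia.
rewrite (_ : j + (size cs - (j - i)) - size cs = i); last lia.
by rewrite (_ : i - j + (j - i) = j - i); [apply|]; lia.
Qed.

End Arcs.

Lemma prev_head (T : eqType) (c : T) s : c \notin s -> prev (c :: s) c = last c s.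
Proof.
suff H d : c \notin s -> prev_at c c d s = last d s by apply: H.
elim: s d => [|a s IH] d /=; first by rewrite eqxx.
by rewrite inE negb_or => /andP[/negPf-> /IH].
Qed.

(** The lower bound forces [l2 < l1], so the truncated difference is the true one. *)
Definition two_paths (T : finType) (e : rel T) (x y : T) :=
  exists l1 l2, [/\ walk e setT x y l1, walk e setT x y l2 & 1 <= l1 - l2 <= 2].

Lemma two_paths_ends (T : finType) (e : rel T) x y s t l1 l2 : symmetric e ->
  ends x y s t -> walk e setT s t l1 -> walk e setT s t l2 ->
  1 <= (l1 - l2) + (l2 - l1) <= 2 -> two_paths e x y.
Proof.
move=> es st w1 w2 d; wlog le : l1 l2 w1 w2 d / l2 <= l1.
  by move=> H; case: (leqP l2 l1) => h; [apply: (H l1 l2) | apply: (H l2 l1) => //; lia].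
exists l1, l2; split; last (by lia); move: st w1 w2; rewrite /ends !inE !xpair_eqE.
all: by move=> /orP[]/andP[/eqP-> /eqP->] // *; apply: walk_rev.
Qed.

(* [x] and [y] may have any degree: the induction creates roots of large degree. *)
Definition rooted (T : finType) (e : rel T) (V : {set T}) (x y z : T) :=
  [/\ [/\ symmetric e, irreflexive e, x \in V, y \in V & x != y],
      forall u v, e u v -> u \in V,
      forall v, v \in V -> v \notin [:: x; y; z] -> degree e v = 3,
      z \notin [:: x; y] -> degree e z <= 3 &
      (forall v w, w \in V -> w != v ->
         exists2 t, t \in [:: x; y] & connect (restr e (~: [set v])) w t)
      /\ exists2 v, v \in V & v \notin [:: x; y; z]].

(** * Cycles leaving as much as possible outside *)

Section Cycles.
Variables (T : finType) (e : rel T) (V : {set T}) (x y z : T).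
Hypothesis G : rooted e V x y z.

Let e_sym : symmetric e. Proof. by case: G => [[]]. Qed.
Let e_irr : irreflexive e. Proof. by case: G => [[]]. Qed.
Let eV u v : e u v -> u \in V. Proof. by case: G => _ H *; apply: (H u v). Qed.
Let deg3 v : v \in V -> v \notin [:: x; y; z] -> degree e v = 3.
Proof. by case: G => _ _ H _ _; apply: H. Qed.
Let conn v w : w \in V -> w != v ->
  exists2 t, t \in [:: x; y] & connect (restr e (~: [set v])) w t.
Proof. by case: G => _ _ _ _ [H _]; apply: H. Qed.

Lemma degree_le v : v \in V -> v \notin [:: x; y] -> degree e v <= 3.
Proof.
move=> vV vxy; have [vz|vz] := eqVneq v z.
  by rewrite vz in vxy *; case: G => _ _ _ + _; apply.
rewrite deg3 //; move: vxy; rewrite !inE !negb_or vz => /andP[-> ->] //.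
Qed.

Definition rcycle cs :=
  [&& cycle e cs, uniq cs, 2 < size cs, x \notin cs & y \notin cs].

(** The component of the two roots off the cycle, once the edge [xy] is added. *)
Definition outside (cs : seq T) : {set T} :=
  [set w | (w \notin cs) &&
     [exists t, (t \in [:: x; y]) && connect (restr e (~: [set a in cs])) w t]].

Lemma outsideP cs w : reflect (w \notin cs /\ exists2 t, t \in [:: x; y] &
    connect (restr e (~: [set a in cs])) w t) (w \in outside cs).
Proof.
rewrite inE; apply: (iffP andP) => [[-> /existsP[t /andP[? ?]]]|[-> [t t1 t2]]].
  by split=> //; exists t.
by split=> //; apply/existsP; exists t; rewrite t1.
Qed.

Lemma outside_notin cs w : w \in outside cs -> w \notin cs.
Proof. by case/outsideP. Qed.

Lemma outside_closed cs w u : w \in outside cs -> e w u -> u \notin cs -> u \in outside cs.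
Proof.
move=> /outsideP[wc [t txy wt]] wu uc; apply/outsideP; split=> //; exists t => //.
apply: connect_trans (connect1 _) wt; apply/and3P; split; rewrite ?inE // e_sym //.
Qed.

Lemma outside_root cs t : rcycle cs -> t \in [:: x; y] -> t \in outside cs.
Proof.
move=> /and5P[_ _ _ xc yc] txy; apply/outsideP; split; last by exists t.
by move: txy; rewrite !inE => /orP[]/eqP->.
Qed.

Lemma outside_reach cs w : w \in outside cs ->
  exists2 t, t \in [:: x; y] & connect (restr e (outside cs)) w t.
Proof.
move=> wK; have /outsideP[wc [t txy wt]] := wK; exists t => //.
have /(connect_mono _) : connect (restr (restr e (~: [set a in cs])) (outside cs)) w t.
  apply: (connect_restr_closed wK _ wt) => u v uK /and3P[uc vc uv].
  by apply: outside_closed uK uv _; rewrite !inE in vc.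
by apply=> u v /and3P[uK vK /and3P[_ _ uv]]; apply/and3P.
Qed.

Lemma rcycle_V cs c : rcycle cs -> c \in cs -> c \in V /\ c \notin [:: x; y].
Proof.
move=> /and5P[cP cu sz xc yc] ccs; split; first exact: eV (next_cycle cP ccs).
rewrite !inE; apply/negP=> /orP[]/eqP cE; first by rewrite -cE ccs in xc.
by rewrite -cE ccs in yc.
Qed.

Lemma rcycle_next_prev cs c : rcycle cs -> c \in cs -> next cs c != prev cs c.
Proof.
move=> /and5P[cP cu sz xc yc] ccs; have [i s E] := rot_to ccs.
rewrite -(next_rot i cu) -(prev_rot i cu) E.
have : uniq (c :: s) by rewrite -E rot_uniq.
have : 2 < size (c :: s) by rewrite -E size_rot.
case: s {E} => [|a [|b s]] // _ us; rewrite prev_head; last by case/andP: us.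
rewrite /= eqxx; case/and3P: us => _ + _; apply: contra => /eqP ->.
exact: mem_last.
Qed.

(** This rules out chords as well, since [outside cs] contains no vertex of the cycle. *)
Definition thirds cs :=
  [forall c, forall u, [&& c \in cs, e c u, u != next cs c & u != prev cs c]
     ==> (u \in outside cs)].

(** A path from the cycle to a root must enter [outside cs]; as that set is closed under edges off
    the cycle, the vertex before the entry is on the cycle. *)
Lemma rcycle_attached cs c : rcycle cs -> c \in cs ->
  exists k k', [/\ k \in cs, k' \in outside cs & e k k'].
Proof.
move=> rc ccs; have [cV cxy] := rcycle_V rc ccs.
have cx : c != x by move: cxy; rewrite !inE negb_or => /andP[].
have [t txy ct] := conn cV cx.
have cK : c \in ~: outside cs by rewrite in_setC; apply/negP=> /outside_notin; rewrite ccs.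
have tK : t \notin ~: outside cs by rewrite in_setC negbK outside_root.
have [k [k' [kK kK' /and3P[_ _ kk'] _]]] := connect_exit ct cK tK.
rewrite in_setC negbK in kK'; exists k, k'; split=> //.
apply/negPn/negP=> kcs; move/setCP: kK; apply.
by apply: outside_closed kK' _ kcs; rewrite e_sym.
Qed.

Lemma card_nbrs4 c u1 u2 u3 u4 : uniq [:: u1; u2; u3; u4] ->
  all (e c) [:: u1; u2; u3; u4] -> 3 < degree e c.
Proof.
move=> us /allP al; rewrite /degree -[4]/(size [:: u1; u2; u3; u4]) -(card_uniqP us).
by apply/subset_leq_card/subsetP=> a /al; rewrite inE.
Qed.

Lemma rcycle_third cs c u k : rcycle cs -> c \in cs -> e c u -> e c k ->
  u != next cs c -> u != prev cs c -> k != next cs c -> k != prev cs c -> u = k.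
Proof.
move=> rc ccs cu ck un up kn kp; apply/eqP/negPn/negP=> uk.
have [cV cxy] := rcycle_V rc ccs; have np := rcycle_next_prev rc ccs.
have /and5P[cP _ _ _ _] := rc.
have := degree_le cV cxy; rewrite leqNgt (@card_nbrs4 c u k (next cs c) (prev cs c)) //.
  by rewrite /= !inE !negb_or uk un up kn kp np.
by rewrite /= cu ck (next_cycle cP ccs) e_sym (prev_cycle cP ccs).
Qed.

Lemma next_notin_outside cs c u : c \in cs -> u \in outside cs ->
  u != next cs c /\ u != prev cs c.
Proof.
move=> ccs /outside_notin uc; split; apply: contra uc => /eqP->.
  by rewrite mem_next.
by rewrite mem_prev.
Qed.

(** The ear with interior [q] replaces the arc that contains [k]. The new cycle still avoids
    [outside cs] and releases [k], which joins the outside through [k']. The last hypothesis keeps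
    an ear without interior from being an edge of the cycle. *)
Lemma rcycle_ear cs c c' q k k' :
  rcycle cs -> c \in cs -> c' \in cs -> c != c' -> k \in cs -> k != c -> k != c' ->
  k' \in outside cs -> e k k' ->
  path e c (rcons q c') -> uniq q -> (forall a, a \in q -> a \notin cs /\ a \notin outside cs) ->
  (q = [::] -> c' != next cs c /\ c' != prev cs c) ->
  exists2 cs', rcycle cs' & #|outside cs| < #|outside cs'|.
Proof.
move=> rc ccs ccs' cc' kcs kc kc' kK kk' qP uq qn qnil.
have grow cs' : rcycle cs' -> k \notin cs' ->
    (forall a, a \in cs' -> a \notin outside cs) ->
    exists2 cs', rcycle cs' & #|outside cs| < #|outside cs'|.
  move=> rc' kcs' sub; exists cs' => //.
  have sub' : outside cs \subset outside cs'.
    apply/subsetP=> w wK; apply/outsideP; split.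
      by apply: contraL wK; apply: sub.
    have [t txy wt] := outside_reach wK; exists t => //.
    apply: connect_restrS wt; apply/subsetP=> a aK; rewrite !inE.
    by apply: contraL aK; apply: sub.
  apply: proper_card; rewrite properE sub' /=; apply/subsetPn; exists k.
    by apply: outside_closed (subsetP sub' _ kK) _ kcs'; rewrite e_sym.
  by apply/negP=> /outside_notin; rewrite kcs.
have /and5P[cP cu csz xc yc] := rc.
(* The cycle is read from [c] on and later split at [c']; [k] lies in one of the two pieces [s1],
   [s2], and the other one is kept. *)
have [i s E] := rot_to ccs.
have memE a : (a \in cs) = (a \in c :: s) by rewrite -E mem_rot.
have us : uniq (c :: s) by rewrite -E rot_uniq.
have Ps : path e c (rcons s c) by have : cycle e (c :: s) by rewrite -E rot_cycle.
have nE : next cs c = head c s.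
  by rewrite -(next_rot i cu) E; case: (s) => /= [|? ?]; rewrite eqxx.
have pE : prev cs c = last c s.
  by rewrite -(prev_rot i cu) E prev_head //; case/andP: us.
rewrite nE pE in qnil.
have c's : c' \in s by move: ccs'; rewrite memE inE eq_sym (negPf cc').
have ks : k \in s by move: kcs; rewrite memE inE (negPf kc).
have qroot t : t \in [:: x; y] -> t \notin q.
  by move=> txy; apply/negP=> /qn[_]; rewrite (outside_root rc txy).
have inK a : a \in q ++ c :: s -> a \notin outside cs.
  rewrite mem_cat -memE => /orP[/qn[]//|]; apply: contraL; exact: outside_notin.
have xqs t : t \in [:: x; y] -> t \notin q ++ c :: s.
  by move=> txy; apply/negP=> /inK; rewrite (outside_root rc txy).
have qs a : a \in q -> a \notin c :: s by move=> /qn[]; rewrite memE.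
have kq : k \notin q by apply/negP=> /qs; rewrite inE ks orbT.
have [xx yy] : x \in [:: x; y] /\ y \in [:: x; y] by rewrite !inE !eqxx orbT.
move: c's us Ps ks memE qs qnil xqs inK => /splitPr[s1 s2] us Ps ks memE qs qnil xqs inK.
move: Ps; rewrite rcons_cat cat_path /= => /and3P[P1 P2 P3].
move: qP; rewrite rcons_path => /andP[qP qc'].
have xqs' t s' : t \in [:: x; y] -> {subset s' <= q ++ c :: s1 ++ c' :: s2} -> t \notin s'.
  by move=> txy sub; apply/negP=> /sub; apply/negP/xqs.
move: us; rewrite /= cat_uniq mem_cat negb_or => /andP[/andP[cs1 ccs2] /and3P[us1 hs us2]].
have k12 : (k \in s1) || (k \in s2) by move: ks; rewrite mem_cat inE (negPf kc').
have hs' : forall a, a \in c' :: s2 -> a \notin s1 by move=> a as2; move/hasPn: hs; apply.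
have [ks2|ks2] := boolP (k \in s2).
- have sub : {subset c :: s1 ++ c' :: rev q <= q ++ c :: s1 ++ c' :: s2}.
    move=> a; rewrite !(mem_cat, inE, mem_rev).
    by case: (a == c); case: (a \in s1); case: (a == c'); case: (a \in q); rewrite ?orbT.
  apply: (grow (c :: s1 ++ c' :: rev q)).
  + apply/and5P; split; try exact: xqs'.
    * rewrite /cycle rcons_cat cat_path P1 /= P2 /= -rev_cons.
      have := rev_path e c (rcons q c'); rewrite last_rcons belast_rcons => ->.
      by apply: sub_path (_ : path e c (rcons q c')) => [a b|]; rewrite /= ?rcons_path ?qP // e_sym.
    * rewrite /= mem_cat cat_uniq us1 /= !inE !mem_rev rev_uniq uq !andbT.
      have c'q : c' \notin q by apply/negP=> /qs; rewrite !inE mem_cat inE eqxx !orbT.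
      have cq : c \notin q by apply/negP=> /qs; rewrite !inE eqxx.
      rewrite (negPf cs1) (negPf cq) (negPf cc') c'q andbT /=; apply/norP; split.
        by apply: hs'; rewrite mem_head.
      apply/hasPn=> a; rewrite mem_rev => /qs; rewrite !inE mem_cat !negb_or.
      by case/andP=> _ /andP[].
    * rewrite /= size_cat /= size_rev; case: (s1) qnil => [|? ?] /=; last by rewrite addSn addnS.
      by case: (q) => [|? ?] // /(_ erefl); rewrite eqxx => -[].
  + rewrite !(mem_cat, inE, mem_rev) (negPf kc) (negPf kc') (negPf kq) !orbF /=.
    by apply: hs'; rewrite inE ks2 orbT.
  + by move=> a /sub /inK.
- have ks1 : k \in s1 by rewrite (negPf ks2) orbF in k12.
  have sub : {subset c :: q ++ c' :: s2 <= q ++ c :: s1 ++ c' :: s2}.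
    move=> a; rewrite !(mem_cat, inE).
    by case: (a == c); case: (a \in s1); case: (a == c'); case: (a \in q); rewrite ?orbT.
  apply: (grow (c :: q ++ c' :: s2)).
  + apply/and5P; split; try exact: xqs'.
    * by rewrite /cycle rcons_cat cat_path qP /= qc'.
    * rewrite /= mem_cat cat_uniq uq us2 andbT negb_or ccs2 andbT.
      have -> : c \notin q by apply/negP=> /qs; rewrite !inE eqxx.
      apply/hasPn=> a as2; apply/negP=> /qs.
      by rewrite !inE mem_cat as2 !orbT.
    * rewrite /= size_cat /=; case: (q) qnil => [|? ?]; last by rewrite addSn addnS.
      case: (s2) => [|? ?] //; by rewrite last_cat /= eqxx => /(_ erefl)[].
  + by rewrite !(mem_cat, inE) (negPf kc) (negPf kc') (negPf kq) (negPf ks2) //.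
  + by move=> a /sub /inK.
Qed.

(** A third neighbour [u] of [c] that is not outside gives a chord if it is on the cycle. If not, a
    path from [u] to a root avoiding [c] first meets the cycle at some [c'], which gives an ear. *)
Lemma rcycle_improve cs : rcycle cs -> ~~ thirds cs ->
  exists2 cs', rcycle cs' & #|outside cs| < #|outside cs'|.
Proof.
move=> rc /forallPn[c /forallPn[u]]; rewrite negb_imply.
move=> /andP[/and4P[ccs cu un up] uK].
have [k [k' [kcs kK kk']]] := rcycle_attached rc ccs.
(* The third edge of [k] goes to the outside, so [k] differs from every vertex of the cycle whose
   third edge does not, in particular from the ends of the ear. *)
have kne d v : d \in cs -> e d v -> v != next cs d -> v != prev cs d ->
    v \notin outside cs -> k != d.
  move=> dcs dv vn vp vK; apply: contra vK => /eqP kd; rewrite -kd in dcs dv vn vp.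
  have [k'n k'p] := next_notin_outside kcs kK.
  by rewrite (rcycle_third rc kcs dv kk').
have kc := kne c u ccs cu un up uK.
have /and5P[cP cu' csz xc yc] := rc.
have [ucs|ucs] := boolP (u \in cs).
  have uc : u != c by apply: contraL cu => /eqP->; rewrite e_irr.
  apply: (@rcycle_ear cs c u [::] k k') => //; first by rewrite eq_sym.
    apply: (kne u c) => //; rewrite 1?e_sym //.
    - by apply: contra up => /eqP->; rewrite (prev_next cu').
    - by apply: contra un => /eqP->; rewrite (next_prev cu').
    - by apply/negP=> /outside_notin; rewrite ccs.
  by rewrite /= cu.
have uV : u \in V by rewrite e_sym in cu; apply: eV cu.
have uc : u != c by apply: contraNN ucs => /eqP->.
have [t txy ut] := conn uV uc.
have uD : u \in ~: outside cs :\: [set a in cs] by rewrite !in_setD in_setC uK inE ucs.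
have tD : t \notin ~: outside cs :\: [set a in cs].
  by rewrite in_setD in_setC (outside_root rc txy) andbF.
have [d [c' [dD cD' /and3P[dc c'c dc'] ud]]] := connect_exit ut uD tD.
move: dD; rewrite in_setD in_setC inE => /andP[dcs dK].
have {cD'}ccs' : c' \in cs.
  move: cD'; rewrite in_setD in_setC inE; have [//|c'cs /=] := boolP (c' \in cs).
  rewrite negbK => c'K; move/negP: dK; case.
  by apply: outside_closed c'K _ dcs; rewrite e_sym.
have [l [q [qP ql uq qS _]]] : exists l, walk e (~: outside cs :\: [set a in cs]) u d l.
  apply: connect_walk => //; move: ud; apply: connect_mono => a b /and3P[aS bS /and3P[_ _ ab]].
  exact/and3P.
apply: (@rcycle_ear cs c c' (u :: q) k k') => //.
- by move: c'c; rewrite !inE eq_sym.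
- apply: (kne c' d) => //; first by rewrite e_sym.
  + by apply: contraNN dcs => /eqP->; rewrite mem_next.
  + by apply: contraNN dcs => /eqP->; rewrite mem_prev.
- by rewrite /= cu rcons_path qP ql.
- by move=> a /qS; rewrite in_setD in_setC inE => /andP[].
Qed.

Lemma rcycle_good cs : rcycle cs -> exists2 cs', rcycle cs' & thirds cs'.
Proof.
have [n] := ubnP (#|T| - #|outside cs|); elim: n cs => // n IH cs le_n rc.
have [th|nth] := boolP (thirds cs); first by exists cs.
have [cs' rc' lt] := rcycle_improve rc nth; apply: IH rc'.
have : #|outside cs'| <= #|T| by apply: max_card.
by move: lt le_n; lia.
Qed.

End Cycles.

(** * A cycle all of whose third edges leave to the outside *)

Section ParityClasses.
Variables (n : nat) (R : rel nat).
Hypotheses (n3 : 2 < n) (Rxx : reflexive R) (Rsym : forall i j, R i j -> R j i).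
(** Position 0 is excepted here and in [Rnear]: it may hold [z], which need not have a neighbour in
    the outside. *)
Hypothesis Rtrans : forall j i k, 0 < j < n -> R i j -> R j k -> R i k.
(** Positions at distance [d] bound arcs of lengths [d] and [n - d], which differ by [n - 2d] up to
    sign. *)
Hypothesis Rnear : forall i j, 0 < i -> i < j < n ->
  1 <= (n - (j - i).*2) + ((j - i).*2 - n) <= 2 -> R i j.

Lemma near_shift i j d : 0 < i -> j = i + d -> j < n -> 0 < d ->
  1 <= (n - d.*2) + (d.*2 - n) <= 2 -> R i j.
Proof. by move=> hi -> hj d0 hd; apply: Rnear => //; lia. Qed.

Lemma classes_rep g c : (forall i, 0 < i < n -> 0 < g i < n) ->
  (forall i, 0 < i < n -> R i (g i)) -> 0 < c < n ->
  forall i j, 0 < i < n -> 0 < j < n -> R (g i) c -> R (g j) c -> R i j.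
Proof.
move=> gn ug hc i j hi hj gi gj.
apply: (Rtrans (gn _ hi) (ug _ hi)); apply: (Rtrans hc gi).
exact: (Rtrans (gn _ hj) (Rsym gj) (Rsym (ug _ hj))).
Qed.

(** With [n = 2h + 1] the admissible distances are [h] and [h + 1]; one step of each moves a
    position by 1. *)
Lemma classes_odd i j : odd n -> 0 < i < n -> 0 < j < n -> R i j.
Proof.
move=> no; have := odd_double_half n; rewrite no add1n; move: n./2 => h nE.
have up k : k < h -> R (h + 1 + k) (h + 1).
  elim: k => [|k IHk] hk; first by rewrite addn0.
  apply: (@Rtrans (h + 1 + k)) (IHk _); [lia| |lia].
  apply: (@Rtrans (k + 1)); first lia.
    by apply/Rsym/(@near_shift _ _ h.+1); lia.
  by apply: (@near_shift _ _ h); lia.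
(* [g] moves the lower positions into the upper half, where [up] applies. *)
pose g i := if i <= h then i + h else i.
have gh k : 0 < k < n -> R (g k) (h + 1).
  rewrite /g => hk; case: ifP => kh.
    by have := up (k - 1); rewrite (_ : h + 1 + (k - 1) = k + h); [apply|]; lia.
  by have := up (k - h - 1); rewrite (_ : h + 1 + (k - h - 1) = k); [apply|]; lia.
move=> hi hj; apply: (@classes_rep g (h + 1)); rewrite ?gh // {gh up} /g; last lia.
- by move=> k hk; case: ifP; lia.
- by move=> k hk; case: ifP => // kh; apply: (@near_shift _ _ h); lia.
Qed.

(** With [n = 2m] the distances [m - 1] and [m + 1] are admissible; one step of each moves a
    position by 2. For even [m] these distances are odd and also join the two parities. *)
Lemma classes_even m i j : n = m.*2 -> 0 < i < n -> 0 < j < n ->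
  ~~ odd m || (odd i == odd j) -> R i j.
Proof.
move=> nE.
pose g i := if i <= m then i + m - 1 else i.
have gn k : 0 < k < n -> 0 < g k < n by rewrite /g; case: ifP; lia.
have ug k : 0 < k < n -> R k (g k).
  by rewrite /g => hk; case: ifP => // km; apply: (@near_shift _ _ (m - 1)); lia.
have up c k : m <= c -> c + k.*2 < n -> R (c + k.*2) c.
  move=> mc; elim: k => [|k IHk] hk; first by rewrite addn0.
  apply: (@Rtrans (c + k.*2)) (IHk _); [lia| |lia].
  apply: (@Rtrans (c + k.*2 - m + 1)); first lia.
    by apply/Rsym/(@near_shift _ _ (m + 1)); lia.
  by apply: (@near_shift _ _ (m - 1)); lia.
have gup k : 0 < k < n -> m <= g k by rewrite /g; case: ifP; lia.
have cls k : 0 < k < n -> R (g k) (m + (odd (g k) != odd m)).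
  move=> hk; move: (gn k hk) (gup k hk); move: (g k) => l ln ml {hk k ug gn gup}.
  set b : nat := odd l != odd m; have := @up (m + b) ((l - m - b)./2).
  by rewrite (_ : m + b + (l - m - b)./2.*2 = l); [apply; lia|rewrite /b; lia].
move=> hi hj; have [mo /eqP oij|me _] := boolP (odd m); last first.
(* The step from [m] to [n - 1] has length [m - 1], which is odd here, so it joins the two parity
   classes. *)
- have mid : R (m + 1) m.
    have := @cls m; rewrite (_ : g m = n - 1); last by rewrite /g leqnn; lia.
    rewrite (_ : odd (n - 1) != odd m); last lia.
    move=> u1; apply: (@Rtrans (n - 1)); [lia|by apply/Rsym/u1; lia|].
    by apply/Rsym/(@near_shift _ _ (m - 1)); lia.
  have cls' k : 0 < k < n -> R (g k) m.
    move=> hk; have := cls k hk; case: (odd (g k) != odd m); rewrite ?addn0 // => u1.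
    by apply: Rtrans u1 mid; lia.
  by apply: (@classes_rep g m) => //; [lia|apply: cls'|apply: cls'].
- have og k : 0 < k < n -> odd (g k) = odd k.
    by rewrite /g; case: ifP => //; move: mo; clear; lia.
  apply: (@classes_rep g (m + (odd i != odd m))) => //; first lia.
    by rewrite -og //; apply: cls.
  by rewrite oij -og //; apply: cls.
Qed.

End ParityClasses.

Definition arclen n i j l :=
  l = (i - j) + (j - i) \/ l = n - ((i - j) + (j - i)).

(* Two even positions on a cycle of length [2m], [m] odd, bound two arcs of even lengths
   [2j] and [2(m - j)]; exactly one of [j] and [m - j] is odd, so exactly one of the two arcs
   has a midpoint in an odd position. *)
Lemma arclen_equal m i i' : odd m -> 2 < m -> ~~ odd i -> ~~ odd i' ->
  i < m.*2 -> i' < m.*2 ->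
  exists b l, [/\ b < m.*2, odd b, arclen m.*2 i b l & arclen m.*2 i' b l].
Proof.
move=> mo m3 oi oi' ltim lti'm.
wlog lei : i i' oi oi' ltim lti'm / i <= i'.
  move=> H; case: (leqP i i') => h; first exact: H.
  by have [|b [l []]] := H i' i oi' oi lti'm ltim; [lia|exists b, l].
rewrite /arclen; case: (ltngtP i i') lei => // [lt _|<- _]; last first.
  by exists 1, (i - 1 + (1 - i)); split=> //; try lia; left.
have [k kE] : exists k, i' = i + k.*2 by exists ((i' - i)./2); lia.
have [ko|ke] := boolP (odd k).
  by exists (i + k), k; split; lia.
case: (ltnP (i' + (m - k)) m.*2) => h.
  by exists (i' + (m - k)), (m - k); split; lia.
by exists (i' + (m - k) - m.*2), (m - k); split; lia.
Qed.

(** At distance [2k], exactly one of the arcs, of lengths [2k] and [2(m - k)], has its midpoint in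
    an even position; [b] is next to that midpoint. *)
Lemma arclen_diff2 m i i' : odd m -> ~~ odd i -> ~~ odd i' -> i < i' < m.*2 ->
  exists b l l', [/\ b < m.*2, odd b, arclen m.*2 i b l, arclen m.*2 i' b l' & l = l'.+2].
Proof.
move=> mo oi oi' /andP[lt lti'm]; rewrite /arclen.
have [k kE] : exists k, i' = i + k.*2 by exists ((i' - i)./2); lia.
have [ko|ke] := boolP (odd k); last by exists (i + k + 1), (k + 1), (k - 1); split; lia.
case: (ltnP (i' + (m - k) - 1) m.*2) => h.
  by exists (i' + (m - k) - 1), (m - k + 1), (m - k - 1); split; lia.
by exists (i' + (m - k) - 1 - m.*2), (m - k + 1), (m - k - 1); split; lia.
Qed.

(** * Contracting the cycle to a second root *)

Section Contraction.
Variables (T : finType) (e : rel T) (M Y : {set T}) (y' : T).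
Hypotheses (e_sym : symmetric e) (yM : y' \notin M) (YM : Y \subset M).

(** The graph induced on [M] with an extra vertex adjacent to exactly [Y]. A vertex [y'] outside [M]
    stands for it, so the type stays [T]. *)
Definition contract : rel T :=
  [rel u v | [|| [&& u \in M, v \in M & e u v],
                 (u == y') && (v \in Y) | (v == y') && (u \in Y)]].

Lemma contract_sym : symmetric contract.
Proof.
move=> u v; rewrite /contract /= e_sym andbCA; congr (_ || _); exact: orbC.
Qed.

(** The vertex [y'] is met only at the end, so the path before it runs inside [M] and stops in
    [Y]. *)
Lemma contract_walk p l : p \in M -> walk contract setT p y' l ->
  exists l' m, [/\ l = l'.+1, m \in Y & walk e M p m l'].
Proof.
move=> pM [s [sP sl su _ <-]]; move: sP sl su; case/lastP: s => [|s w].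
  by move=> _ /= py; case/negP: yM; rewrite -py.
rewrite rcons_path last_rcons => /andP[sP sw] wy; rewrite {w}wy in sw *.
rewrite -rcons_cons rcons_uniq => /andP[ys su]; exists (size s), (last p s).
have lY : last p s \in Y.
  move: sw; rewrite /contract /= (negPf yM) andbF /= eqxx /= => /orP[]//.
  by case/andP=> /eqP ly; rewrite -ly mem_last in ys.
split=> //; first by rewrite size_rcons.
suff [sP' sM] : path e p s /\ {subset p :: s <= M} by exists s.
elim: s p pM sP ys {su sw lY} => [|a s IH] p pM /=.
  by move=> _ _; split=> // b; rewrite inE => /eqP->.
move=> /andP[pa sP]; rewrite inE negb_or => /andP[yp ys].
have [aM epa] : a \in M /\ e p a.
  move: pa; rewrite /contract /= => /or3P[/and3P[_ -> ->] //||] /andP[/eqP E _].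
    by rewrite E eqxx in yp.
  by rewrite -E mem_head in ys.
have [-> sM] := IH a aM sP ys; rewrite epa; split=> // b.
by rewrite inE => /orP[/eqP-> //|/sM].
Qed.

End Contraction.

(** * Paths through a cycle with at most one outside neighbour per vertex *)

Section Final.
Variables (T : finType) (e : rel T) (V : {set T}) (x y z : T).
Hypothesis G : rooted e V x y z.
Hypothesis IH : forall (e' : rel T) (V' : {set T}) x' y', #|V'| < #|V| ->
  rooted e' V' x' y' z -> two_paths e' x' y'.

Let e_sym : symmetric e. Proof. by case: G => [[]]. Qed.
Let e_irr : irreflexive e. Proof. by case: G => [[]]. Qed.
Let xV : x \in V. Proof. by case: G => [[]]. Qed.
Let yV : y \in V. Proof. by case: G => [[]]. Qed.
Let xy : x != y. Proof. by case: G => [[]]. Qed.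
Let eV u v : e u v -> u \in V. Proof. by case: G => _ H *; apply: (H u v). Qed.
Let deg3 v : v \in V -> v \notin [:: x; y; z] -> degree e v = 3.
Proof. by case: G => _ _ H _ _; apply: H. Qed.
Let conn v w : w \in V -> w != v ->
  exists2 t, t \in [:: x; y] & connect (restr e (~: [set v])) w t.
Proof. by case: G => _ _ _ _ [H _]; apply: H. Qed.

Variable cs : seq T.
Hypothesis rc : rcycle e x y cs.
Let K := outside e x y cs.
Let n := size cs.
Let cn i := nth x cs i.
Let C := [set a in cs].
Hypothesis attached : forall c, c \in cs -> c != z -> exists2 w, w \in K & e c w.
Hypothesis attach1 : forall c w w', c \in cs -> w \in K -> w' \in K ->
  e c w -> e c w' -> w = w'.
Hypothesis z_head : z \in cs -> z = cn 0.

Let csP : cycle e cs. Proof. by case/and5P: rc. Qed.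
Let csu : uniq cs. Proof. by case/and5P: rc. Qed.
Let cs3 : 2 < n. Proof. by case/and5P: rc. Qed.
Let xK : x \in K. Proof. by apply: (outside_root rc); rewrite !inE eqxx. Qed.
Let yK : y \in K. Proof. by apply: (outside_root rc); rewrite !inE eqxx orbT. Qed.
Let Kcs w : w \in K -> w \notin cs. Proof. exact: outside_notin. Qed.
Let Knbr w u : w \in K -> e w u -> u \notin cs -> u \in K.
Proof. exact: (outside_closed G). Qed.
Let reachK w : w \in K -> exists2 t, t \in [:: x; y] & connect (restr e K) w t.
Proof. exact: (outside_reach G). Qed.
Let cn_in i : i < n -> cn i \in cs. Proof. exact: mem_nth. Qed.

Let KC_disj (S : {set T}) : S \subset K -> [disjoint S & C].
Proof.
move=> /subsetP SK; apply/pred0P=> a /=; apply/negP=> /andP[/SK /Kcs].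
by rewrite inE => /negPf->.
Qed.

Lemma outside_join (S S' : {set T}) s t u v a b l k l' :
  S \subset K -> S' \subset K -> [disjoint S & S'] ->
  walk e S s u l -> e u a -> walk e C a b k -> e b v -> walk e S' v t l' ->
  walk e setT s t (l + k + l').+2.
Proof.
move=> SK SK' dis w1 ua w2 bv w3.
have w12 := walk_edge w1 ua w2 (KC_disj SK).
have dis' : [disjoint S :|: C & S'].
  by rewrite -setI_eq0 setIUl setU_eq0 !setI_eq0 dis disjoint_sym KC_disj.
exact: walkS (subsetT _) (walk_edge w12 bv w3 dis').
Qed.

(** Linking paths from [u] and [v] extend both arcs by the same length. Either [a' = a], with the
    two arcs to [b], or [a] and [a'] are two vertices sharing the neighbour [u]. *)
Lemma outside_close a a' b u v l1 l2 : e a u -> e a' u -> e b v -> linked e x y K u v ->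
  walk e C a b l1 -> walk e C a' b l2 -> 1 <= (l1 - l2) + (l2 - l1) <= 2 ->
  two_paths e x y.
Proof.
move=> au a'u bv /(linkedE e_sym)[S [S' [s [t [[dis SK SK'] [uS vS' st] us vt]]]]] w1 w2 d.
have [l wl] := connect_walk uS (us _ uS); have [l' wl'] := connect_walk vS' (vt _ vS').
have wr := walk_rev e_sym wl.
rewrite e_sym in au; rewrite e_sym in a'u.
apply: (two_paths_ends e_sym st (outside_join SK SK' dis wr au w1 bv wl')
                       (outside_join SK SK' dis wr a'u w2 bv wl')).
by move: d; clear; lia.
Qed.

(** The neighbour of [c] in [K], unique by [attach1]; the default [x] is taken only when [att c]
    fails. *)
Let f c := odflt x [pick w | (w \in K) && e c w].
Let att c := [exists w, (w \in K) && e c w].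

Let fP c : att c -> f c \in K /\ e c (f c).
Proof.
move=> /existsP[w wP]; rewrite /f; case: pickP => [w' /andP[]//|/(_ w)].
by rewrite wP.
Qed.

Let fE c w : c \in cs -> w \in K -> e c w -> att c /\ f c = w.
Proof.
move=> ccs wK cw; have ac : att c by apply/existsP; exists w; rewrite wK.
by split=> //; have [fK cf] := fP ac; apply: (attach1 ccs).
Qed.

Let att_pos i : 0 < i < n -> att (cn i).
Proof.
move=> /andP[i0 i_n]; have [|w wK cw] := attached (cn_in i_n).
  apply/eqP=> iz; have zcs : z \in cs by rewrite -iz cn_in.
  have := nth_uniq x i_n (ltn_trans i0 i_n) csu.
  by rewrite -/(cn i) -/(cn 0) iz -(z_head zcs) eqxx => /esym/eqP i0'; rewrite i0' in i0.
by apply/existsP; exists w; rewrite wK.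
Qed.

Let unl i j := ~~ linked e x y K (f (cn i)) (f (cn j)).
Let unl_sym i j : unl i j -> unl j i.
Proof. by apply: contra => /(linked_sym e_sym). Qed.
Let unl_trans j i k : att (cn j) -> unl i j -> unl j k -> unl i k.
Proof. by move=> /fP[fK _]; apply: (unlinked_trans e_sym reachK). Qed.

Let near i j := [&& att (cn i), att (cn j), i < j &
  1 <= (n - (j - i).*2) + ((j - i).*2 - n) <= 2].

Lemma near_unlinked : two_paths e x y \/ forall i j, j < n -> near i j -> unl i j.
Proof.
have [/forallP H|/forallPn[i /forallPn[j]]] :=
  boolP [forall i : 'I_n, forall j : 'I_n, near i j ==> unl i j].
  right=> i j jn nij; have i_n : i < n by case/and4P: nij => _ _ ij _; apply: ltn_trans jn.
  by have /forallP/(_ (Ordinal jn))/implyP := H (Ordinal i_n); apply.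
rewrite negb_imply negbK => /andP[/and4P[ai aj ij d] lk]; left.
have [_ ei] := fP ai; have [_ ej] := fP aj.
have arc l : l = j - i \/ l = n - (j - i) -> walk e C (cn i) (cn j) l.
  move=> hl; apply: arc_walk; rewrite ?ltn_ord //; first by rewrite neq_ltn ij.
  by rewrite (_ : i - j = 0) //; move: ij; clear; lia.
apply: (outside_close ei ei ej lk (arc _ (or_introl erefl)) (arc _ (or_intror erefl))).
by move: d ij (ltn_ord j); clear; lia.
Qed.

Let arc i j l : i < n -> j < n -> i != j -> arclen n i j l -> walk e C (cn i) (cn j) l.
Proof. by move=> *; apply: arc_walk. Qed.

(** Otherwise the vertex [p] at which the class hangs would separate the cycle from every root other
    than [p]. *)
Lemma linkclass_not_all m0 : m0 \in K ->
  exists i, [/\ i < n, att (cn i) & f (cn i) \notin linkclass e x y K m0].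
Proof.
move=> m0K; set M := linkclass e x y K m0.
have [/existsP[i /andP[ai fi]]|nex] := boolP [exists i : 'I_n, att (cn i) && (f (cn i) \notin M)].
  by exists i; split.
have all_M c : c \in cs -> att c -> f c \in M.
  move=> ccs ac; apply/negPn/negP=> fM; move/negP: nex; apply; apply/existsP.
  have ic : index c cs < n by rewrite index_mem.
  by exists (Ordinal ic); rewrite /cn /= nth_index // ac.
have [p pM top] := linkclass_top e_sym xy xK yK reachK m0K.
have pK : p \in K by move: pM; rewrite inE => /andP[].
have c0 : cn 0 \in cs by apply: cn_in; apply: ltn_trans cs3.
have [c0V _] := rcycle_V G rc c0.
have cp : cn 0 != p by apply: contraNN (Kcs pK) => /eqP <-.
have [t txy ct] := conn c0V cp.
(* Every edge leaving [S] ends in [p]: from [M] by the choice of [p], and from outside [K] because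
   such an edge starts on the cycle and so ends in [M]. *)
pose S := [set w | (w \notin K) || (w \in M) && (w != p)].
have cS : cn 0 \in S by rewrite inE (contraL (@Kcs _)).
have tK : t \in K by apply: (outside_root rc).
have tS : t \notin S.
  rewrite inE tK /=; apply/negP=> /andP[tM tp].
  by have [] := top _ tM tp; rewrite txy.
have [u [v [uS vS /and3P[up vp uv] _]]] := connect_exit ct cS tS.
move: vS; rewrite in_set negb_or negbK => /andP[vK vM]; rewrite in_setC1 in vp.
rewrite vp andbT in vM; case/negP: vM.
move: uS; rewrite in_set => /orP[uK|/andP[uM uneq]]; last first.
  by have [_] := top _ uM uneq; apply.
have ucs : u \in cs.
  by apply/negPn/negP=> ucs; case/negP: uK; apply: Knbr vK _ ucs; rewrite e_sym.
by have [au <-] := fE ucs vK uv; apply: all_M.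
Qed.

Lemma unlinked_not_all k : 0 < k < n ->
  ~ (forall i, i < n -> att (cn i) -> unl i k).
Proof.
move=> hk H; have [fK _] := fP (att_pos hk).
have [i [i_n ai]] := linkclass_not_all fK; rewrite inE.
by have [-> _] := fP ai; rewrite -/(unl i k) H.
Qed.

(** Nearly opposite positions are unlinked, so all attached positions form one class unless [n = 2m]
    with [m] odd, and [unlinked_not_all] forbids a single class. Position 2 represents the even ones
    because position 0 may be unattached. *)
Lemma linkclass_parity : (forall i j, j < n -> near i j -> unl i j) ->
  exists m, [/\ n = m.*2, odd m, 2 < m &
    forall i, i < n -> att (cn i) ->
      (f (cn i) \in linkclass e x y K (f (cn 2))) = ~~ odd i].
Proof.
move=> H.
have inM i k : att (cn i) -> (f (cn i) \in linkclass e x y K (f (cn k))) = unl i k.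
  by move=> /fP[fK _]; rewrite inE fK.
have Rxx : reflexive unl by move=> i; apply: linked_irr.
have Rtrans j i k : 0 < j < n -> unl i j -> unl j k -> unl i k.
  by move=> hj; apply: unl_trans (att_pos hj).
have Rnear i j : 0 < i -> i < j < n ->
    1 <= (n - (j - i).*2) + ((j - i).*2 - n) <= 2 -> unl i j.
  move=> i0 /andP[ij jn] d; apply: H => //; apply/and4P; split=> //; apply: att_pos.
    by rewrite i0 (ltn_trans ij).
  by rewrite jn (ltn_trans i0).
have R0 j : 0 < j < n -> att (cn 0) -> 1 <= (n - j.*2) + (j.*2 - n) <= 2 -> unl 0 j.
  move=> /andP[j0 jn] a0 d; apply: H => //; apply/and4P; split; rewrite ?subn0 //.
  by apply: att_pos; rewrite j0.
have r1 : 0 < 1 < n by rewrite (ltn_trans _ cs3).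
have r2 : 0 < 2 < n by [].
have half : n = odd n + n./2.*2 by rewrite odd_double_half.
(* If position 0 is attached, the nearly opposite position [k] brings it into the common class. *)
have full k : 0 < k < n -> 1 <= (n - k.*2) + (k.*2 - n) <= 2 ->
    (forall i j, 0 < i < n -> 0 < j < n -> unl i j) -> False.
  move=> hk d all_unl; apply: (unlinked_not_all r1) => -[|i] i_n ai; last exact: all_unl.
  by apply: (Rtrans k) => //; [apply: R0|apply: all_unl].
have [no|ne] := boolP (odd n).
  case: (full n./2) => [||i j]; last exact: (classes_odd cs3 Rxx unl_sym Rtrans Rnear).
  - by rewrite no in half; move: half cs3; clear; lia.
  - by rewrite no in half; move: half cs3; clear; lia.
rewrite (negPf ne) add0n in half; move: (n./2) half => m nE.
have Reven i j := classes_even cs3 Rxx unl_sym Rtrans Rnear (i := i) (j := j) nE.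
have hm : 0 < m - 1 < n by move: nE cs3; clear; lia.
have dm : 1 <= (n - (m - 1).*2) + ((m - 1).*2 - n) <= 2 by move: nE cs3; clear; lia.
have [mo|me] := boolP (odd m); last first.
  by case: (full (m - 1)) => // i j hi hj; apply: Reven; rewrite ?me.
have m3 : 2 < m by move: nE cs3 mo; clear; case: m => [|[|[|m]]] //= ->.
exists m; split=> // i i_n ai; rewrite inM //.
have even2 j : j < n -> att (cn j) -> ~~ odd j -> unl j 2.
  case: j => [|j] jn aj oj; last by apply: Reven => //; rewrite mo (negPf oj).
  apply: (Rtrans (m - 1)) => //; first exact: R0.
  by apply: Reven => //; rewrite oddB ?mo //; apply: ltnW; apply: ltnW.
have [oi|oi] /= := boolP (odd i); last exact: even2.
(* One odd position unlinked from 2 would merge the two classes. *)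
apply/negbTE/negP=> ui2; apply: (unlinked_not_all r2) => j jn aj.
have [oj|oj] := boolP (odd j); last exact: even2.
have pos k : odd k -> k < n -> 0 < k < n by case: k.
have ji : unl j i by apply: (Reven _ _ (pos _ oj jn) (pos _ oi i_n)); rewrite oi oj orbT.
exact: (Rtrans i j 2 (pos _ oi i_n) ji ui2).
Qed.

Let K_V w : w \in K -> w \in V.
Proof.
move=> /reachK[t txy /connectP[[|a s] /= + tE]] => [_|/andP[/and3P[_ _ /eV]//]].
by rewrite tE in txy; move: txy; rewrite !inE => /orP[]/eqP->.
Qed.

(** * The link class of the even positions *)

Section ParityCase.
Variables (m p : T) (h : nat).
Let M := linkclass e x y K m.
Hypothesis pM : p \in M.
Hypothesis top : forall w, w \in M -> w != p ->
  w \notin [:: x; y] /\ forall u, u \in K -> e w u -> u \in M.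
Hypotheses (nE : n = h.*2) (h_odd : odd h) (h3 : 2 < h).
Hypothesis inM : forall i, i < n -> att (cn i) -> (f (cn i) \in M) = ~~ odd i.

Let M_K w : w \in M -> w \in K.
Proof. by rewrite inE => /andP[]. Qed.

Let even_nbr i w : i < n -> w \in M -> e (cn i) w -> ~~ odd i.
Proof.
move=> i_n wM ci; have [ai fi] := fE (cn_in i_n) (M_K wM) ci.
by rewrite -inM // fi.
Qed.

Lemma odd_linked w b : w \in M -> b < n -> odd b ->
  [/\ f (cn b) \in K, e (cn b) (f (cn b)) & linked e x y K w (f (cn b))].
Proof.
move=> wM bn ob; have hb : 0 < b < n by case: (b) ob bn.
have [fK cf] := fP (att_pos hb); split=> //.
have [//|nl] := boolP (linked e x y K w (f (cn b))).
have := inM bn (att_pos hb); rewrite ob /= => /negP; case; rewrite inE fK.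
apply: (unlinked_trans e_sym reachK (M_K wM)).
  by apply: contra nl => /(linked_sym e_sym).
by move: wM; rewrite inE => /andP[].
Qed.

(** Both positions are even, so some odd [b] is reached from them by arcs whose lengths differ by 2,
    and [w] is linked to the neighbour of [b]. *)
Lemma shared_nbr_two_paths w i i' : w \in M -> i < i' < n ->
  e (cn i) w -> e (cn i') w -> two_paths e x y.
Proof.
move=> wM /andP[ii' i'n] ci ci'; have i_n := ltn_trans ii' i'n.
have oi := even_nbr i_n wM ci; have oi' := even_nbr i'n wM ci'.
have [|b [l [l' []]]] := arclen_diff2 h_odd oi oi'; first by rewrite ii' -nE.
rewrite -nE => bn ob al al' ll.
have [_ cb lk] := odd_linked wM bn ob.
have neq j : ~~ odd j -> j != b by apply: contraNneq => ->.
apply: (outside_close ci ci' cb lk (arc i_n bn (neq _ oi) al) (arc i'n bn (neq _ oi') al')).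
by rewrite ll; clear; lia.
Qed.

(** Inside [K] the class can be left only through [p], and the path ends at a root, while no root
    other than [p] is in [M]. *)
Lemma path_avoids_linkclass u s : path e u s -> {subset u :: s <= K} ->
  last u s \in [:: x; y] -> p \notin u :: s -> forall a, a \in u :: s -> a \notin M.
Proof.
elim: s u => [|v s IHs] u /=.
  move=> _ _ uxy pu a; rewrite inE => /eqP->; apply/negP=> uM.
  by have [|+ _] := top uM; [rewrite inE eq_sym in pu | rewrite uxy].
move=> /andP[uv sP] sK lxy; rewrite inE negb_or => /andP[pu ps].
have sub : {subset v :: s <= K} by move=> a as_; apply: sK; rewrite inE as_ orbT.
have IHv := IHs v sP sub lxy ps.
move=> a; rewrite inE => /orP[/eqP->|]; last exact: IHv.
apply/negP=> uM; have [|_ /(_ v)] := top uM; first by rewrite eq_sym.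
by move=> /(_ (sub _ (mem_head _ _)) uv) vM; have := IHv _ (mem_head _ _); rewrite vM.
Qed.

Let Y := [set w in M | [exists c, (c \in cs) && e c w]].
Let y' := cn 0.
Let e' := contract e M Y y'.
Let V' := y' |: M.

Hypothesis M_nbr1 : forall w c c', w \in M -> c \in cs -> c' \in cs ->
  e c w -> e c' w -> c = c'.

Let n0 : 0 < n. Proof. exact: ltn_trans cs3. Qed.
Let y'M : y' \notin M.
Proof. by apply: contraL (cn_in n0) => /M_K /Kcs. Qed.
Let YM : Y \subset M.
Proof. by apply/subsetP=> w; rewrite inE => /andP[]. Qed.

Let M_split v u : v \in M -> v != p -> e v u -> (u \in M) || (u \in cs).
Proof.
move=> vM vp vu; have [//|ucs] := boolP (u \in cs); first by rewrite orbT.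
by have [_ ->] := top vM vp => //; apply: Knbr (M_K vM) vu ucs.
Qed.

(** By [M_nbr1] a vertex of [M] has at most one neighbour on the cycle, and contraction replaces it
    by [y']. *)
Lemma contract_degree v : v \in M -> v != p -> degree e' v = degree e v.
Proof.
move=> vM vp; rewrite /degree; pose A := [set w in M | e v w].
have AE w : (w \in A) = (w \in M) && e v w by rewrite in_set.
have NE (r : rel T) w : (w \in [set w | r v w]) = r v w by rewrite in_set.
have vy : v != y' by apply: contraNneq y'M => <-.
have [/existsP[c /andP[ccs cv]]|nY] := boolP [exists c, (c \in cs) && e c v].
  have vY : v \in Y by rewrite inE vM; apply/existsP; exists c; rewrite ccs.
  have -> : [set w | e' v w] = y' |: A.
    apply/setP=> w; rewrite in_setU1 AE NE /e' /contract /= vM (negPf vy) vY andbT /=.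
    exact: orbC.
  have -> : [set w | e v w] = c |: A.
    apply/setP=> w; rewrite in_setU1 AE NE.
    have [->|wc] /= := eqVneq w c; first by rewrite e_sym.
    have [vw|] := boolP (e v w); last by rewrite andbF.
    have := M_split vM vp vw; rewrite andbT => /orP[-> //|wcs].
    by case/eqP: wc; apply: (M_nbr1 vM wcs ccs); rewrite // e_sym.
  have cM : c \notin M by apply: contraL ccs => /M_K /Kcs.
  by rewrite !cardsU1 !AE (negPf y'M) (negPf cM).
have vY : v \notin Y by rewrite in_set vM.
apply: eq_card => w; rewrite !NE /e' /contract /= vM (negPf vy) (negPf vY) andbF orbF /=.
have [vw|] := boolP (e v w); last by rewrite andbF.
rewrite andbT; have /orP[->//|wcs] := M_split vM vp vw.
by case/existsP: nY; exists w; rewrite wcs e_sym.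
Qed.

(** A path to a root leaves [M :\ p] either into [p] or into the cycle, which has become [y']. *)
Lemma contract_conn v w : w \in V' -> w != v ->
  exists2 t, t \in [:: p; y'] & connect (restr e' (~: [set v])) w t.
Proof.
move=> wV wv; have [wpy|] := boolP (w \in [:: p; y']); first by exists w.
rewrite !inE negb_or => /andP[wp wy].
have wM : w \in M by move: wV; rewrite in_setU1 (negPf wy).
pose S := M :\ p; have wS : w \in S by rewrite !in_setD1 wp.
have rootS t : t \in [:: x; y] -> t \notin S.
  move=> txy; rewrite in_setD1; apply/negP=> /andP[tp tM].
  by have [] := top tM tp; rewrite txy.
have stay a b : a \in S -> b \in S -> a != v -> b != v -> e a b -> restr e' (~: [set v]) a b.
  move=> aS bS av bv ab; apply/and3P; rewrite !in_setC1; split=> //.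
  by apply/or3P/Or31; rewrite ab (subsetP (subsetDl _ _) _ aS) (subsetP (subsetDl _ _) _ bS).
have outp u : u \in S -> u != v -> p != v -> e u p -> restr e' (~: [set v]) u p.
  move=> uS uv pv up; apply/and3P; rewrite !in_setC1; split=> //.
  by apply/or3P/Or31; rewrite up pM (subsetP (subsetDl _ _) _ uS).
(* With [y'] deleted, a path inside [K] is followed instead: it cannot enter the cycle, so it leaves
   through [p]. *)
have [vy|vy] := eqVneq v y'.
  have [t txy wt] := reachK (M_K wM).
  have [u [u' [uS uS' /and3P[uK uK' uu'] wu]]] := connect_exit wt wS (rootS _ txy).
  have neq a : a \in M -> a != v by rewrite vy; apply: contraTneq => ->.
  have /andP[up uM] : (u != p) && (u \in M) by rewrite -in_setD1.
  have u'p : u' = p.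
    have [_ /(_ _ uK' uu') uM'] := top uM up.
    by move: uS'; rewrite in_setD1 uM' andbT negbK => /eqP.
  exists p; first exact: mem_head.
  apply: connect_trans (_ : connect _ w u) (connect1 _); last first.
    by rewrite -u'p in outp *; apply: outp => //; [exact: neq | rewrite u'p; exact: neq].
  move: wu; apply: connect_mono => a b /and3P[aS bS /and3P[_ _ ab]].
  by apply: stay => //; apply: neq; apply: (subsetP (subsetDl _ _)); eauto.
have [t txy wt] := conn (K_V (M_K wM)) wv.
have [u [u' [uS uS' /and3P[uv u'v uu'] wu]]] := connect_exit wt wS (rootS _ txy).
rewrite !in_setC1 in uv u'v.
have wu' : connect (restr e' (~: [set v])) w u.
  move: wu; apply: connect_mono => a b /and3P[aS bS /and3P[av bv ab]].
  by rewrite !in_setC1 in av bv; apply: stay.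
have /andP[up uM] : (u != p) && (u \in M) by rewrite -in_setD1.
have /orP[uM'|ucs'] := M_split uM up uu'.
  have u'p : u' = p by move: uS'; rewrite in_setD1 uM' andbT negbK => /eqP.
  rewrite u'p in u'v uu'.
  exists p; first exact: mem_head.
  by apply: connect_trans wu' (connect1 _); apply: outp.
exists y'; first by rewrite !inE eqxx orbT.
apply: connect_trans wu' (connect1 _); apply/and3P; rewrite !in_setC1 uv eq_sym vy; split=> //.
apply/or3P/Or33; rewrite eqxx inE uM; apply/existsP; exists u'.
by rewrite ucs' e_sym.
Qed.

Lemma contract_rooted : rooted e' V' p y' z.
Proof.
have py : p != y' by apply: contraNneq y'M => <-.
split.
- split=> //; first exact: contract_sym.
  + move=> v; rewrite /e' /contract /= e_irr !andbF /= orbb; apply/negP=> /andP[/eqP->].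
    by move/(subsetP YM); rewrite (negPf y'M).
  + by rewrite in_setU1 pM orbT.
  + by rewrite setU11.
- move=> u v /or3P[/and3P[uM _ _]|/andP[/eqP-> _]|/andP[_ /(subsetP YM) uM]];
  by rewrite in_setU1 ?uM ?eqxx ?orbT.
- move=> v /setU1P vV; rewrite 2!in_cons mem_seq1 !negb_or => /and3P[vp vy vz].
  have vM : v \in M by case: vV vy => [->|//]; rewrite eqxx.
  rewrite contract_degree // deg3 ?K_V ?M_K //.
  have [] := top vM vp; rewrite !inE !negb_or => /andP[-> ->] _.
  by rewrite vz.
- rewrite !inE negb_or => /andP[zp zy].
  have [zM|zM] := boolP (z \in M).
    rewrite contract_degree //; apply: (degree_le G); first exact/K_V/M_K.
    by have [] := top zM zp.
  rewrite /degree (_ : [set w | e' z w] = set0) ?cards0 //.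
  apply/setP=> w; rewrite !in_set /e' /contract /= (negPf zM) (negPf zy) /=.
  by apply/negP=> /andP[_ /(subsetP YM)]; rewrite (negPf zM).
- split; first exact: contract_conn.
  (* The neighbours at positions 2 and 4 are distinct vertices of [M]. If [z] is on the cycle, it is
     not in [M] and one of them differs from [p]; otherwise position 0 supplies a third vertex, one
     more than [p] and [z] can cover. *)
  suff [v vM /andP[vp vz]] : exists2 v, v \in M & (v != p) && (v != z).
    exists v; first by rewrite in_setU1 vM orbT.
    by rewrite !inE !negb_or vp vz andbT /=; apply: contraNneq y'M => <-.
  have n6 : 5 < n by rewrite nE; move: h3; clear; lia.
  have n4 : 4 < n := ltnW n6; have n2 : 2 < n by [].
  have fM i : i < n -> ~~ odd i -> att (cn i) -> f (cn i) \in M by move=> ? ? ?; rewrite inM.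
  have f_inj i j : i < n -> j < n -> att (cn i) -> att (cn j) -> f (cn i) \in M ->
      f (cn i) = f (cn j) -> i = j.
    move=> i_n jn ai aj fiM fE'; have [_ ci] := fP ai; have [_ cj] := fP aj.
    rewrite -fE' in cj; have := M_nbr1 fiM (cn_in i_n) (cn_in jn) ci cj.
    by move/eqP; rewrite /cn nth_uniq // => /eqP.
  have a2 : att (cn 2) by apply: att_pos.
  have a4 : att (cn 4) by apply: att_pos.
  have f24 : f (cn 2) != f (cn 4).
    by apply/eqP=> /(f_inj 2 4 n2 n4 a2 a4 (fM 2 n2 isT a2)).
  have [zcs|zcs] := boolP (z \in cs).
    have zM v : v \in M -> v != z.
      by rewrite (z_head zcs); apply: contraTneq => ->.
    have [f2p|f2p] := eqVneq (f (cn 2)) p.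
      exists (f (cn 4)); rewrite ?zM ?fM // andbT.
      by rewrite -f2p eq_sym.
    by exists (f (cn 2)); rewrite ?zM ?fM // f2p.
  have a0 : att (cn 0).
    have [|w wK cw] := attached (cn_in n0); first by apply: contraNneq zcs => <-; apply: cn_in.
    by apply/existsP; exists w; rewrite wK.
  have f02 : f (cn 0) != f (cn 2).
    by apply/eqP=> /(f_inj 0 2 n0 n2 a0 a2 (fM 0 n0 isT a0)).
  have f04 : f (cn 0) != f (cn 4).
    by apply/eqP=> /(f_inj 0 4 n0 n4 a0 a4 (fM 0 n0 isT a0)).
  have pick i : i < n -> ~~ odd i -> att (cn i) -> f (cn i) \notin [:: p; z] ->
      exists2 v, v \in M & (v != p) && (v != z).
    by move=> i_n oi ai; rewrite !inE negb_or; exists (f (cn i)) => //; apply: fM.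
  have [h0|] := boolP (f (cn 0) \in [:: p; z]); last exact: pick.
  have [h2|] := boolP (f (cn 2) \in [:: p; z]); last exact: pick.
  have [h4|] := boolP (f (cn 4) \in [:: p; z]); last exact: pick.
  move: h0 h2 h4 f24 f02 f04; rewrite !inE.
  by move=> /orP[]/eqP-> /orP[]/eqP-> /orP[]/eqP->; rewrite ?eqxx.
Qed.

Lemma contract_card : #|V'| < #|V|.
Proof.
have n1 : 1 < n by apply: ltn_trans cs3.
apply: proper_card; apply/properP; split.
  apply/subsetP=> a; rewrite in_setU1 => /orP[/eqP->|/M_K/K_V //].
  by have [] := rcycle_V G rc (cn_in n0).
exists (cn 1); first by have [] := rcycle_V G rc (cn_in n1).
rewrite in_setU1 /y' /cn nth_uniq //=; apply: contraL (cn_in n1) => /M_K /Kcs //.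
Qed.

Lemma contract_two_paths : two_paths e x y.
Proof.
have [l1 [l2 [w1 w2 d]]] := IH contract_card contract_rooted.
have [k1 [m1 [E1 mY1 u1]]] := contract_walk y'M pM w1.
have [k2 [m2 [E2 mY2 u2]]] := contract_walk y'M pM w2.
have nbr w : w \in Y -> exists i, [/\ i < n, ~~ odd i & e w (cn i)].
  rewrite inE => /andP[wM /existsP[c /andP[ccs cw]]].
  have ic : index c cs < n by rewrite index_mem.
  have cE : cn (index c cs) = c by rewrite /cn nth_index.
  exists (index c cs); rewrite cE e_sym; split=> //.
  by apply: even_nbr ic wM _; rewrite cE.
have [i1 [i1n oi1 e1]] := nbr _ mY1; have [i2 [i2n oi2 e2]] := nbr _ mY2.
(* Arcs of one common length [l] lead from both positions to the odd position [b], so the difference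
   of the two lengths survives. *)
have [||b [l []]] := arclen_equal h_odd h3 oi1 oi2; rewrite -?nE // => bn ob al1 al2.
have [fK cf lk] := odd_linked pM bn ob.
have [S [S' [s [t [[dis SK SK'] [pS fS' st] ps ft]]]]] := linkedE e_sym lk.
have rootst : (s \in [:: x; y]) && (t \in [:: x; y]).
  by move: st; rewrite /ends !inE !xpair_eqE => /orP[]/andP[-> ->]; rewrite ?orbT.
have [sxy txy] := andP rootst.
have pS' : p \notin S' by rewrite (disjointFr dis pS).
have [ls [qs [qP ql qu qS qsz]]] := connect_walk pS (ps _ pS).
have [lt wt] := connect_walk fS' (ft _ fS').
(* The path from the neighbour of [b] to its root avoids [M], and the one from [p] to the other root
   meets [M] only in [p]; both can therefore be joined to paths inside [M]. *)
have {}wt : walk e (S' :\: M) (f (cn b)) t lt.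
  case: wt => q [q1 q2 q3 q4 q5]; exists q; split=> // a aq.
  rewrite in_setD q4 // andbT; apply: (path_avoids_linkclass q1 _ _ _ aq).
  - by move=> c /q4 /(subsetP SK').
  - by rewrite q2.
  - by apply: contra pS' => /q4.
have ws : walk e (p |: (S :\: M)) s p ls.
  apply: walk_rev => //; exists qs; split=> // a; rewrite in_cons in_setU1.
  case/orP=> [-> //|aq]; have aS : a \in S by apply: qS; rewrite inE aq orbT.
  apply/orP; right; rewrite in_setD aS andbT.
  case: (qs) qP ql qu qS aq => // c q /andP[pc cq] ql qu qS aq.
  apply: (path_avoids_linkclass cq _ _ _ aq).
  - by move=> g gq; apply: (subsetP SK); apply: qS; rewrite inE gq orbT.
  - by move: ql => /= ->.
  - by case/andP: qu.
pose S1 := (p |: (S :\: M)) :|: M.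
have S1K : S1 \subset K.
  rewrite !subUset sub1set (M_K pM) (subset_trans (subsetDl _ _) SK) /=.
  by apply/subsetP=> a /M_K.
have S2K : S' :\: M \subset K by apply: subset_trans (subsetDl _ _) SK'.
have dis' : [disjoint S1 & S' :\: M].
  apply/pred0P=> a /=; apply/negP=> /andP[]; rewrite !in_setU in_set1 !in_setD.
  move=> /orP[/orP[/eqP->|/andP[_ aS]]|aM] /andP[aM' aS'].
  - by rewrite aS' in pS'.
  - by rewrite (disjointFr dis aS) in aS'.
  - by rewrite aM in aM'.
have glue k w : walk e M p w k -> walk e S1 s w (ls + k).
  move=> wk; apply: walk_glue ws wk _ => a; rewrite in_setU1 in_setD.
  by case/orP=> [/eqP //|/andP[/negPf->]].
have neq j : ~~ odd j -> j != b by apply: contraNneq => ->.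
have p1 := outside_join S1K S2K dis' (glue _ _ u1) e1 (arc i1n bn (neq _ oi1) al1) cf wt.
have p2 := outside_join S1K S2K dis' (glue _ _ u2) e2 (arc i2n bn (neq _ oi2) al2) cf wt.
apply: (two_paths_ends e_sym st p1 p2).
by move: d; rewrite E1 E2; clear; lia.
Qed.

End ParityCase.

Lemma good_rcycle_two_paths : two_paths e x y.
Proof.
have [//|H] := near_unlinked.
have [h [nE h_odd h3 inM]] := linkclass_parity H.
have [mK _] := fP (@att_pos 2 cs3).
have [p pM top] := linkclass_top e_sym xy xK yK reachK mK.
have [/existsP[w /existsP[i /existsP[j /and5P[wM ij jn ci cj]]]]|nex] := boolP
  [exists w, exists i : 'I_n, exists j : 'I_n,
    [&& w \in linkclass e x y K (f (cn 2)), i < j, j < n, e (cn i) w & e (cn j) w]].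
  by apply: (shared_nbr_two_paths nE h_odd inM wM _ ci cj); rewrite ij.
apply: (contract_two_paths pM top nE h_odd h3 inM) => w c c' wM ccs ccs' cw cw'.
have ic : index c cs < n by rewrite index_mem.
have ic' : index c' cs < n by rewrite index_mem.
have no i j : i < n -> j < n -> e (cn i) w -> e (cn j) w -> i < j -> False.
  move=> i_n jn ci cj ij; case/negP: nex; apply/existsP; exists w; apply/existsP.
  by exists (Ordinal i_n); apply/existsP; exists (Ordinal jn); apply/and5P.
case: (ltngtP (index c cs) (index c' cs)) => [lt|lt|eq_i].
- by case: (no _ _ ic ic' _ _ lt); rewrite /cn nth_index.
- by case: (no _ _ ic' ic _ _ lt); rewrite /cn nth_index.
- by rewrite -(nth_index x ccs) eq_i nth_index.
Qed.

End Final.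

(** * Acyclic case *)

Section Forest.
Variables (T : finType) (e : rel T) (V : {set T}) (x y z : T).
Hypothesis G : rooted e V x y z.

Let e_sym : symmetric e. Proof. by case: G => [[]]. Qed.
Let e_irr : irreflexive e. Proof. by case: G => [[]]. Qed.
Let xy : x != y. Proof. by case: G => [[]]. Qed.
Let eV u v : e u v -> u \in V. Proof. by case: G => _ H *; apply: (H u v). Qed.
Let deg3 v : v \in V -> v \notin [:: x; y; z] -> degree e v = 3.
Proof. by case: G => _ _ H _ _; apply: H. Qed.
Let conn v w : w \in V -> w != v ->
  exists2 t, t \in [:: x; y] & connect (restr e (~: [set v])) w t.
Proof. by case: G => _ _ _ _ [H _]; apply: H. Qed.

Lemma third_nbr v a b : v \in V -> v \notin [:: x; y; z] ->
  exists2 w, e v w & w \notin [:: a; b].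
Proof.
move=> vV vxyz; have := deg3 vV vxyz; rewrite /degree => d3.
have [/subsetP sub|/subsetPn[w]] := boolP ([set w | e v w] \subset [:: a; b]); last first.
  by rewrite inE => vw wab; exists w.
have := subset_leq_card (introT subsetP sub); rewrite d3 => /leq_trans/(_ (card_size _)) //.
Qed.

(** A vertex of the cycle other than [z] has degree 3, hence a third edge, which [thirds] sends
    outside; no vertex has two such edges. *)
Lemma good_thirds cs : rcycle e x y cs -> thirds e x y cs ->
  (forall c, c \in cs -> c != z -> exists2 w, w \in outside e x y cs & e c w) /\
  (forall c w w', c \in cs -> w \in outside e x y cs -> w' \in outside e x y cs ->
     e c w -> e c w' -> w = w').
Proof.
move=> rc /forallP th; split=> [c ccs cz|c w w' ccs wK wK' cw cw'].
  have [cV cxy] := rcycle_V G rc ccs.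
  have cxyz : c \notin [:: x; y; z].
    by move: cxy; rewrite !inE !negb_or cz => /andP[-> ->].
  have [w cw] := third_nbr (next cs c) (prev cs c) cV cxyz.
  rewrite !inE negb_or => /andP[wn wp]; exists w => //.
  by have /forallP/(_ w) := th c; rewrite ccs cw wn wp.
have [wn wp] := next_notin_outside ccs wK; have [wn' wp'] := next_notin_outside ccs wK'.
exact: (rcycle_third G rc ccs).
Qed.

Lemma rcycle_two_paths cs :
  (forall (e' : rel T) (V' : {set T}) x' y', #|V'| < #|V| ->
     rooted e' V' x' y' z -> two_paths e' x' y') ->
  rcycle e x y cs -> two_paths e x y.
Proof.
move=> IH /(rcycle_good G)[{}cs rc th]; have [att att1] := good_thirds rc th.
(* This puts [z] first. If [z] is not on the cycle, [index] is the length and the rotation changes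
   nothing. *)
pose cs' := rot (index z cs) cs.
have memE : cs' =i cs by move=> a; rewrite mem_rot.
have oE : outside e x y cs' = outside e x y cs.
  have CE : [set a in cs'] = [set a in cs] by apply/setP=> a; rewrite !inE memE.
  by apply/setP=> a; rewrite !inE memE CE.
have rc' : rcycle e x y cs'.
  by move: rc; rewrite /rcycle !memE rot_cycle rot_uniq size_rot.
apply: (good_rcycle_two_paths G IH rc'); rewrite ?oE.
- by move=> c; rewrite memE; apply: att.
- by move=> c w w'; rewrite memE; apply: att1.
- by rewrite memE => zcs; rewrite /cs' (rot_index zcs).
Qed.

Hypothesis cycle_two_paths : forall cs, rcycle e x y cs -> two_paths e x y.

(** Paths of the graph without [x] and [y], given by all their vertices. *)
Definition hpath s := [&& sorted e s, uniq s & all [predC [:: x; y]] s].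
Definition longest s := hpath s /\ forall s', hpath s' -> size s' <= size s.

Let hpath_tl u s : hpath (u :: s) -> hpath s.
Proof.
by case/and3P=> /= /path_sorted ss /andP[_ us] /andP[_ al]; apply/and3P.
Qed.

Lemma longest_rev s : longest s -> longest (rev s).
Proof.
move=> [/and3P[ss us al] mx]; split; last by move=> s' /mx; rewrite size_rev.
rewrite /hpath rev_sorted rev_uniq all_rev us al andbT andbT.
by move: ss; apply: sub_sorted => a b; rewrite /= e_sym.
Qed.

Lemma hpath_chord u v s w : hpath (u :: v :: s) -> w \in s -> e u w -> two_paths e x y.
Proof.
move=> hp /splitPr sE uw; move: hp; case: sE => s1 s2.
rewrite (_ : [:: u, v & s1 ++ w :: s2] = [:: u, v & rcons s1 w] ++ s2); last by rewrite -cat_rcons.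
rewrite /hpath all_cat cat_uniq => /and3P[/cat_sorted2[sP _] /and3P[us _ _] /andP[/allP al _]].
apply: (@cycle_two_paths [:: u, v & rcons s1 w]); apply/and5P; split=> //.
- by move: sP => /=; rewrite !rcons_path /= last_rcons [e w u]e_sym uw andbT.
- by rewrite /= size_rcons.
- by apply/negP=> /al; rewrite /= !inE eqxx.
- by apply/negP=> /al; rewrite /= !inE eqxx orbT.
Qed.

Definition leaf u v := [forall w, e u w ==> (w \in [:: v; x; y])].

(** Any further neighbour of [u] would extend the path if it is off the path, and close a cycle
    avoiding the roots if it is on it. *)
Lemma longest_leaf u v s : longest (u :: v :: s) -> two_paths e x y \/ leaf u v.
Proof.
move=> [hp mx]; have [lf|/forallPn[w]] := boolP (leaf u v); first by right.
rewrite negb_imply in_cons negb_or => /andP[uw /andP[wv wxy]]; left.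
have [ws|ws] := boolP (w \in u :: v :: s).
  move: ws; rewrite !inE (negPf wv) => /orP[/eqP wu|ws]; first by rewrite wu e_irr in uw.
  exact: hpath_chord hp ws uw.
have /and3P[sP us al] := hp; have /mx : hpath (w :: u :: v :: s); last by rewrite /= ltnn.
by apply/and3P; split; [rewrite /= e_sym uw | rewrite cons_uniq ws | apply/andP].
Qed.

Lemma leaf_roots u v : leaf u v -> u \in V -> u \notin [:: x; y; z] -> e u x /\ e u y.
Proof.
move=> /forallP lf uV uxyz; split.
- have [w uw] := third_nbr v y uV uxyz; have := lf w; rewrite uw !inE.
  by case/or3P=> /eqP wE; rewrite wE in uw *; rewrite ?eqxx ?orbT.
- have [w uw] := third_nbr v x uV uxyz; have := lf w; rewrite uw !inE.
  by case/or3P=> /eqP wE; rewrite wE in uw *; rewrite ?eqxx ?orbT.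
Qed.

(** This serves ends of unknown degree, such as [z]: with [v] deleted, [w] must still reach a
    root. *)
Lemma leaf_root w v : leaf w v -> w \in V -> w != v -> w \notin [:: x; y] -> e w x \/ e w y.
Proof.
move=> /forallP lf wV wv wxy; have [t txy wt] := conn wV wv.
have ww : w \in [set w] by rewrite inE.
have tw : t \notin [set w] by rewrite inE; apply: contraNneq wxy => <-.
have [u [u' [/set1P-> _ /and3P[_ u'v wu'] _]]] := connect_exit wt ww tw.
rewrite in_setC1 in u'v; have := lf u'; rewrite wu' !inE (negPf u'v) /=.
by case/orP=> /eqP<-; [left|right].
Qed.

Let walkI s : path e x s -> last x s = y -> uniq (x :: s) -> walk e setT x y (size s).
Proof. by move=> *; exists s; split=> // a _; rewrite inE. Qed.

Let two_pathsI s s' : path e x s -> last x s = y -> uniq (x :: s) ->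
  path e x s' -> last x s' = y -> uniq (x :: s') -> 1 <= size s - size s' <= 2 ->
  two_paths e x y.
Proof. by move=> *; exists (size s), (size s'); split=> //; apply: walkI. Qed.

(** The path through [u] alone has 2 edges. A root adjacent to [v] gives a path with 3 edges;
    otherwise a third neighbour [w] of [v] is again the end of a longest path, and a path through
    [w], [v], [u] has 4 edges. *)
Lemma longest_end u v s : longest (u :: v :: s) -> u != z -> v != z -> two_paths e x y.
Proof.
move=> lg uz vz; have [//|lf] := longest_leaf lg; have [hp mx] := lg.
have /and3P[/=/andP[uv sP] /andP[us /andP[vs uns]] /and3P[uxy vxy al]] := hp.
have uV : u \in V := eV uv; have vV : v \in V by rewrite e_sym in uv; apply: eV uv.
have xyz a : a != z -> a \notin [:: x; y] -> a \notin [:: x; y; z].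
  by move=> az; rewrite !inE !negb_or az => /andP[-> ->].
have [ux uy] := leaf_roots lf uV (xyz _ uz uxy).
have neq a : a \notin [:: x; y] -> [/\ x != a, y != a, a != x & a != y].
  by rewrite !inE negb_or ![_ == a]eq_sym => /andP[-> ->].
have [nxu nyu nux nuy] := neq _ uxy; have [nxv nyv nvx nvy] := neq _ vxy.
have nuv : u != v by move: us; rewrite inE negb_or => /andP[].
have xuy : path e x [:: u; y] by rewrite /= e_sym ux uy.
have uxuy : uniq [:: x; u; y] by rewrite /= !inE !negb_or nxu xy nuy.
have [vx|nvx'] := boolP (e v x).
  apply: (@two_pathsI [:: v; u; y] [:: u; y]) => //; first by rewrite /= e_sym vx e_sym uv uy.
  by rewrite /= !inE !negb_or nxv nxu xy [v == u]eq_sym nuv nvy nuy.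
have [vy|nvy'] := boolP (e v y).
  apply: (@two_pathsI [:: u; v; y] [:: u; y]) => //; first by rewrite /= e_sym ux uv vy.
  by rewrite /= !inE !negb_or nxv nxu xy nuv nvy nuy.
have [w vw] := third_nbr u (head u s) vV (xyz _ vz vxy).
rewrite !inE negb_or => /andP[wu wh].
have wxy : w \notin [:: x; y].
  by rewrite !inE negb_or; apply/andP; split; apply/eqP=> wE; rewrite wE in vw;
     rewrite vw in nvx' nvy'.
have wv : w != v by apply: contraTneq vw => ->; rewrite e_irr.
have [ws|ws] := boolP (w \in s).
  case: (s) hp ws wh => // a s' /hpath_tl hp; rewrite inE => /orP[/eqP->|ws _].
    by rewrite eqxx.
  exact: hpath_chord hp ws vw.
have lg' : longest (w :: v :: s).
  split=> //; apply/and3P; split; rewrite /= ?sP ?[e w v]e_sym ?vw ?vs ?uns ?wxy ?vxy ?al //=.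
  by rewrite inE negb_or wv ws.
have [//|lf'] := longest_leaf lg'.
have wV : w \in V by rewrite e_sym in vw; apply: eV vw.
have [nxw nyw nwx nwy] := neq _ wxy.
have [wx|wy] := leaf_root lf' wV wv wxy.
  apply: (@two_pathsI [:: w; v; u; y] [:: u; y]) => //.
    by rewrite /= e_sym wx e_sym vw e_sym uv uy.
  by rewrite /= !inE !negb_or nxw nxv nxu xy wv wu nwy [v == u]eq_sym nuv nvy nuy.
apply: (@two_pathsI [:: u; v; w; y] [:: u; y]) => //.
  by rewrite /= e_sym ux uv vw wy.
by rewrite /= !inE !negb_or nxw nxv nxu xy [v == w]eq_sym [u == w]eq_sym wv wu nwy nuv nvy nuy.
Qed.

Lemma longest_two u : longest [:: u; z] -> u != z -> two_paths e x y.
Proof.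
move=> lg uz; have [//|lf] := longest_leaf lg.
have [//|lf'] := longest_leaf (longest_rev lg).
have [/and3P[/=/andP[uz' _] _ /and3P[uxy zxy _]] _] := lg.
have uV : u \in V := eV uz'; have zV : z \in V by rewrite e_sym in uz'; apply: eV uz'.
have uxyz : u \notin [:: x; y; z] by move: uxy; rewrite !inE !negb_or uz => /andP[-> ->].
have [ux uy] := leaf_roots lf uV uxyz.
have zu : z != u by rewrite eq_sym.
move: (zxy) (uxy); rewrite !inE !negb_or => /andP[nzx nzy] /andP[nux nuy].
have [zx|zy] := leaf_root lf' zV zu zxy.
  apply: (@two_pathsI [:: z; u; y] [:: u; y]) => //=.
  - by rewrite e_sym zx e_sym uz' uy.
  - by rewrite !inE !negb_or ![x == _]eq_sym nzx nux zu nzy nuy eq_sym xy.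
  - by rewrite e_sym ux uy.
  - by rewrite !inE !negb_or ![x == _]eq_sym nux nuy eq_sym xy.
apply: (@two_pathsI [:: u; z; y] [:: u; y]) => //=.
- by rewrite e_sym ux uz' zy.
- by rewrite !inE !negb_or ![x == _]eq_sym nzx nux uz nzy nuy eq_sym xy.
- by rewrite e_sym ux uy.
- by rewrite !inE !negb_or ![x == _]eq_sym nux nuy eq_sym xy.
Qed.

(** Both ends are adjacent to both roots, which gives a path with 4 edges through [z] and one with 2
    edges. *)
Lemma longest_three u v : longest [:: u; z; v] -> two_paths e x y.
Proof.
move=> lg; have [//|lf] := longest_leaf lg.
have [//|lf'] := longest_leaf (longest_rev lg).
have [/and3P[/=/and3P[uz' zv' _] un /and4P[uxy zxy vxy _]] _] := lg.
move: un; rewrite !inE !negb_or andbT => /andP[/andP[uz uv] zv].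
have uV : u \in V := eV uz'; have vV : v \in V by rewrite e_sym in zv'; apply: eV zv'.
move: (uxy) (vxy) (zxy); rewrite !inE !negb_or => /andP[nux nuy] /andP[nvx nvy] /andP[nzx nzy].
have uxyz : u \notin [:: x; y; z] by rewrite !inE !negb_or uz nux nuy.
have vxyz : v \notin [:: x; y; z] by rewrite !inE !negb_or [v == z]eq_sym zv nvx nvy.
have [ux uy] := leaf_roots lf uV uxyz; have [vx vy] := leaf_roots lf' vV vxyz.
apply: (@two_pathsI [:: u; z; v; y] [:: u; y]) => //=.
- by rewrite e_sym ux uz' zv' vy.
- by rewrite !inE !negb_or ![x == _]eq_sym nzx nux nvx uz zv uv nzy nuy nvy eq_sym xy.
- by rewrite e_sym ux uy.
- by rewrite !inE !negb_or ![x == _]eq_sym nux nuy eq_sym xy.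
Qed.

Lemma longest_exists : exists s, longest s /\ 1 < size s.
Proof.
have [_ _ _ _ [_ [v vV vxyz]]] := G.
(* A vertex of degree 3 has a neighbour besides the two roots, so a longest path has at least 2
   vertices. *)
have [w vw wxy] := third_nbr x y vV vxyz.
have h2 : hpath [:: v; w].
  apply/and3P; split; rewrite /= ?vw ?andbT //.
    by rewrite inE; apply: contraTneq vw => ->; rewrite e_irr.
  by move: vxyz wxy; rewrite !inE !negb_or => /and3P[-> -> _].
pose P k := [exists t : k.-tuple T, hpath t].
have exP : exists k, P k by exists 2; apply/existsP; exists [tuple v; w].
have ubP k : P k -> k <= #|T|.
  case/existsP=> t /and3P[_ /card_uniqP + _]; rewrite size_tuple => <-; exact: max_card.
have Pin s : hpath s -> P (size s) by move=> hs; apply/existsP; exists (in_tuple s).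
case: (ex_maxnP exP ubP) => k /existsP[t ht] mx; exists t; split; last first.
  by rewrite size_tuple; apply: (mx 2); apply: (Pin [:: v; w]).
by split=> // s' /Pin/mx; rewrite size_tuple.
Qed.

(** If [z] is among the first two vertices, the longest path is reversed. This fails only for two
    vertices, or for three with [z] in the middle. *)
Lemma forest_two_paths : two_paths e x y.
Proof.
have [[|u [|v s]] [lg //]] := longest_exists; move=> _.
have [uz|uz] := eqVneq u z; last have [vz|vz] := eqVneq v z; last exact: longest_end lg uz vz.
- have un : uniq (u :: v :: s) by case: lg => /and3P[].
  have := longest_rev lg; move: un lg; rewrite {u}uz; case/lastP: s => [|s b].
    by move=> un _ lg; apply: longest_two lg _; move: un; rewrite /= inE eq_sym andbT.
  case/lastP: s => [|s a].
    rewrite /= !inE => /and3P[/norP[zv zb] _ _] lg lg'.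
    by apply: (longest_end lg'); rewrite eq_sym.
  rewrite /= !(inE, mem_rcons) !negb_or => /and3P[/and4P[zv zb za _] _ _] lg.
  rewrite (_ : rev _ = [:: b, a & rev [:: z, v & s]]); last first.
    by rewrite -!rcons_cons !rev_rcons.
  by move=> lg'; apply: (longest_end lg'); rewrite eq_sym.
- have un : uniq (u :: v :: s) by case: lg => /and3P[].
  have := longest_rev lg; move: un lg uz; rewrite {v}vz; case/lastP: s => [|s b].
    by move=> un lg uz _; apply: longest_two lg uz.
  case/lastP: s => [|s a]; first by move=> _ lg _ _; apply: longest_three lg.
  rewrite /= !(inE, mem_rcons) => /and3P[_ /norP[zb /norP[za _]] _] lg uz.
  rewrite (_ : rev _ = [:: b, a & rev [:: u, z & s]]); last first.
    by rewrite -!rcons_cons !rev_rcons.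
  by move=> lg'; apply: (longest_end lg'); rewrite eq_sym.
Qed.

End Forest.

(** * The induction on the number of vertices, and the theorem *)

Lemma rooted_two_paths (T : finType) (e : rel T) (V : {set T}) (x y z : T) :
  rooted e V x y z -> two_paths e x y.
Proof.
have [k] := ubnP #|V|; elim: k e V x y => // k IHk e V x y leVk G.
apply: (forest_two_paths G) => cs; apply: (rcycle_two_paths G) => e' V' x' y' ltV.
by apply: IHk; apply: leq_trans ltV _.
Qed.

Theorem theorem4p3 (T : finType) (e : rel T)
    (e_sym : symmetric e) (e_irr : irreflexive e)
    (G_2conn : k_connected e 2) (G_subcubic : subcubic e)
    (x y z : T) (xy : x != y) (xz : x != z) (yz : y != z)
    (deg3 : forall v, v \notin [:: x; y; z] -> degree e v = 3) :
  exists P1 P2 : seq T,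
    [/\ is_path e x y P1, is_path e x y P2 & 1 <= size P1 - size P2 <= 2].
Proof.
have conn v u w : u != v -> w != v -> connect (restr e (~: [set v])) u w.
  move=> uv wv; have [_ /(_ [set v])] := G_2conn; rewrite cards1 => /(_ isT u w).
  rewrite !inE => /(_ uv wv); apply: connect_mono => a b /and3P[av bv ab].
  by apply/and3P; rewrite !in_setC.
have walk_path l : walk e setT x y l -> exists2 P, is_path e x y P & size P = l.
  by case=> s [sP sl su _ <-]; exists s => //; apply/and3P; rewrite sl.
have [/existsP[v vxyz]|nex] := boolP [exists v, v \notin [:: x; y; z]].
  suff [l1 [l2 [/walk_path[P1 p1 <-] /walk_path[P2 p2 <-] d]]] : two_paths e x y by exists P1, P2.
  apply: (@rooted_two_paths _ e setT x y z); split=> //.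
  - by move=> v' _; apply: deg3.
  - split=> [v' w _ wv|]; last by exists v.
    have [xv|xv] := eqVneq x v'; last by exists x; [rewrite mem_head|apply: conn].
    exists y; first by rewrite !inE eqxx orbT.
    by apply: conn; rewrite // -xv eq_sym.
(* With no further vertex the graph is a triangle: deleting one vertex leaves two that must be
   adjacent. *)
have cover a : a \in [:: x; y; z] by apply: contraR nex => ?; apply/existsP; exists a.
have edge a b c : [:: x; y; z] =i [:: a; b; c] -> a != c -> b != c -> a != b -> e a b.
  move=> abc ac bc ab; have aa : a \in [set a] by rewrite inE.
  have ba : b \notin [set a] by rewrite inE eq_sym.
  have [u [u' [/set1P-> u'a /and3P[_ u'c au'] _]]] := connect_exit (conn c a b ac bc) aa ba.
  have := cover u'; rewrite abc !inE in u'a u'c *.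
  by rewrite (negPf u'a) (negPf u'c) orbF /= => /eqP<-.
have exy : e x y by apply: (edge x y z).
have exz : e x z.
  by apply: (edge x z y); rewrite 1?[z == y]eq_sym // => a; rewrite !inE [(a == y) || _]orbC.
have ezy : e z y.
  apply: (edge z y x); rewrite 1?[_ == x]eq_sym // 1?eq_sym // => a.
  by rewrite !inE orbCA orbC -orbA [(a == x) || _]orbC orbA orbC orbA.
exists [:: z; y], [:: y]; split=> //.
  by rewrite /is_path /= exz ezy !inE negb_or xy xz eq_sym yz eqxx.
by rewrite /is_path /= exy inE xy eqxx.
Qed.
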